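(* Let $d>1$, let $X(t)=\sum_i\beta_i g(t-\tau_i)$, $t\in\mathbb{R}^d$, be a shot noise random field, let $\mathbb{D}_a\subset\mathbb{R}^d$ be the closed centered ball of radius $a>0$, $u\in\mathbb{R}$, and $C_u(\mathbb{D}_a)=\{t\in\mathbb{D}_a:X(t)=u\}$. Assume that: (1) the sample paths of $X$ are $C^k(\mathbb{D}_a)$ for some $k\ge1$; (2) for this $k$ and some integer $m\ge1$, $\max_{|v|=1}\mathbf{E}\left(\left|\frac{\partial^kX}{\partial v^k}\right|_\infty^m\right)<\infty$; (3) there is a constant $C>0$ such that the density of $X(t)$ is bounded on $\mathbb{R}$ by $C$ uniformly in $t\in\mathbb{D}_a$. Then $$\mathbf{E}\left(\mathcal{H}_{d-1}(C_u(\mathbb{D}_a))^p\right)<\infty$$ for every $p\ge1$ with $p<\frac{m}{m+1}(k-1)$.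
   Context: In the shot noise field, $(\beta_i)$ (the impulses) is a sequence of i.i.d. integrable random variables, $(\tau_i)$ is a Poisson field on $\mathbb{R}^d$ with constant intensity $\lambda>0$, independent of $(\beta_i)$, and $g:\mathbb{R}^d\to\mathbb{R}$ (the kernel) belongs to $L^1(\mathbb{R}^d)$. $\frac{\partial^k}{\partial v^k}$ is the $k$-th directional derivative with respect to $v\in\mathbb{R}^d$, $|\cdot|_\infty$ is the supremum norm over $\mathbb{D}_a$, and $\mathcal{H}_{d-1}$ is the $(d-1)$-dimensional Hausdorff measure. *)

(* Defs.v *)
From HB Require Import structures.
From mathcomp Require Import all_boot all_order all_algebra.
From mathcomp Require Import all_classical all_reals all_analysis.

Set Implicit Arguments.
Unset Strict Implicit.
Unset Printing Implicit Defensive.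

Import Order.TTheory GRing.Theory Num.Theory.
Import numFieldNormedType.Exports.

Local Open Scope classical_set_scope.
Local Open Scope ring_scope.

(* Points of R^d are row vectors 'rV[R]_d.  The library norm on 'rV[R]_d is the
   maximum norm, so the Euclidean norm is introduced separately; both induce the
   same topology, hence the library notions of interior, continuity and
   directional derivative apply. *)
Definition enorm (R : realType) (d : nat) (x : 'rV[R]_d) : R :=
  Num.sqrt (\sum_(i < d) x ord0 i ^+ 2).

Definition cball (R : realType) (d : nat) (a : R) : set 'rV[R]_d :=
  [set t | enorm t <= a].
Arguments cball {R} d a.

Definition usphere (R : realType) (d : nat) : set 'rV[R]_d :=
  [set v | enorm v = 1].

(* The sigma-algebra on R^d is generated by the coordinates, as the library does
   for tuples; R being second countable, it is the Borel sigma-algebra. *)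

Definition rV_display : measure_display. Proof. exact: default_measure_display. Qed.

Section measurable_rV.
Context {R : realType} (n : nat).

Let coord (i : 'I_n) (v : 'rV[R]_n) : R := v ord0 i.

Let rV_set0 : g_sigma_preimage coord set0.
Proof. exact: sigma_algebra0. Qed.

Let rV_setC A : g_sigma_preimage coord A -> g_sigma_preimage coord (~` A).
Proof. exact: sigma_algebraC. Qed.

Let rV_bigcup (F : _^nat) : (forall i, g_sigma_preimage coord (F i)) ->
  g_sigma_preimage coord (\bigcup_i (F i)).
Proof. exact: sigma_algebra_bigcup. Qed.

HB.instance Definition _ := @isMeasurable.Build rV_display
  'rV[R]_n (g_sigma_preimage coord) rV_set0 rV_setC rV_bigcup.

Lemma measurable_coord (i : 'I_n) :
  measurable_fun [set: 'rV[R]_n] (fun v => v ord0 i : R).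
Proof.
move=> _ Y mY; rewrite setTI; apply: sub_sigma_algebra => /=.
rewrite -bigcup_seq/=; exists i => /=; first by rewrite mem_index_enum.
by exists Y => //; rewrite setTI.
Qed.

Lemma measurable_fun_rV d (T : measurableType d) (f : T -> 'rV[R]_n) :
  (forall i, measurable_fun [set: T] (fun x => f x ord0 i : R)) ->
  measurable_fun [set: T] f.
Proof.
move=> mf; have : g_sigma_preimage (fun i => coord i \o f) `<=` measurable.
  apply: smallest_sub; first exact: sigma_algebra_measurable.
  rewrite -bigcup_seq; apply: bigcup_sub => i _ A [B mB <-].
  exact: mf.
by rewrite g_sigma_preimage_comp => prefS _ A mA; apply: prefS; exists A.
Qed.

End measurable_rV.

Section lebesgue_measure_rV.
Context {R : realType}.

Definition rV_cons n (p : R * 'rV[R]_n) : 'rV[R]_n.+1 :=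
  \row_i (if unlift ord0 i is Some j then p.2 ord0 j else p.1).

Lemma measurable_rV_cons n : measurable_fun setT (@rV_cons n).
Proof.
apply: measurable_fun_rV => i; case: (unliftP ord0 i) => [j|] ->.
  under eq_fun do rewrite mxE liftK.
  by apply: (measurableT_comp (measurable_coord j)); exact: measurable_snd.
under eq_fun do rewrite mxE unlift_none.
exact: measurable_fst.
Qed.

Definition lebesgue_consM n (mu : {sigma_finite_measure set 'rV[R]_n -> \bar R})
    : set 'rV[R]_n.+1 -> \bar R :=
  pushforward (lebesgue_measure \x mu)%E (@rV_cons n).

Section lebesgue_consM.
Context n (mu : {sigma_finite_measure set 'rV[R]_n -> \bar R}).

Let lebesgue_consM0 : lebesgue_consM mu set0 = 0%E.
Proof. by rewrite /lebesgue_consM /pushforward preimage_set0 measure0. Qed.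

Let lebesgue_consM_ge0 A : (0 <= lebesgue_consM mu A)%E.
Proof. by rewrite /lebesgue_consM /pushforward; exact: measure_ge0. Qed.

Let lebesgue_consM_sigma_additive : semi_sigma_additive (lebesgue_consM mu).
Proof.
exact: (@measure_semi_sigma_additive _ _ _
  (measure_function_pushforward__canonical__measure_function_Measure
    (lebesgue_measure \x mu)%E (@measurable_rV_cons n))).
Qed.

HB.instance Definition _ := isMeasure.Build _ _ _ (lebesgue_consM mu)
  lebesgue_consM0 lebesgue_consM_ge0 lebesgue_consM_sigma_additive.

Let lebesgue_consM_sigma_finite : sigma_finite setT (lebesgue_consM mu).
Proof.
have /sigma_finiteP[F [UF ndF Foo]] :=
  sigma_finiteT (@lebesgue_measure R : {sigma_finite_measure set _ -> \bar R}).
have /sigma_finiteP[G [UG ndG Goo]] := sigma_finiteT mu.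
pose uncons (v : 'rV[R]_n.+1) : R * 'rV[R]_n :=
  (v ord0 ord0, \row_j v ord0 (lift ord0 j)).
have unconsK p : uncons (rV_cons p) = p.
  case: p => x v; rewrite /uncons !mxE unlift_none; congr pair.
  by apply/rowP => j; rewrite !mxE liftK.
have muncons : measurable_fun setT uncons.
  apply: measurable_fun_pair; first exact: measurable_coord.
  by apply: measurable_fun_rV => j; under eq_fun do rewrite mxE;
    exact: measurable_coord.
exists (fun k => uncons @^-1` (F k `*` G k)).
  apply/esym; rewrite -subTset => v _.
  have [i _ Fi] : (\bigcup_i F i) (uncons v).1 by rewrite -UF.
  have [j _ Gj] : (\bigcup_i G i) (uncons v).2 by rewrite -UG.
  exists (maxn i j) => //; split.
    by move: Fi; apply/subsetPset/ndF/leq_maxl.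
  by move: Gj; apply/subsetPset/ndG/leq_maxr.
move=> k; have [mFk Fkoo] := Foo k; have [mGk Gkoo] := Goo k; split.
  by rewrite -[X in measurable X]setTI; apply: muncons => //; exact: measurableX.
rewrite /lebesgue_consM /pushforward -comp_preimage (_ : uncons \o _ = id).
  by rewrite preimage_id product_measure1E// lte_mul_pinfty// ge0_fin_numE.
by apply/funext => p /=; exact: unconsK.
Qed.

HB.instance Definition _ := Measure_isSigmaFinite.Build _ _ _ (lebesgue_consM mu)
  lebesgue_consM_sigma_finite.

End lebesgue_consM.

(* Lebesgue measure on R^n: a point mass for n = 0, and Lebesgue measure on R
   times Lebesgue measure on R^n, transported to R^n.+1 by rV_cons. *)
Fixpoint lebesgue_rV n : {sigma_finite_measure set 'rV[R]_n -> \bar R} :=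
  match n with
  | 0 => \d_(0 : 'rV[R]_0)
  | n'.+1 => lebesgue_consM (lebesgue_rV n')
  end.

End lebesgue_measure_rV.

Section hausdorff.
Context {R : realType} {n : nat}.
Local Open Scope ereal_scope.

Definition diameter (E : set 'rV[R]_n) : \bar R :=
  ereal_sup [set r | r = 0 \/ exists x y, [/\ E x, E y & r = (enorm (x - y)%R)%:E]].

(* Normalization making s-dimensional Hausdorff measure on R^s equal to Lebesgue
   measure. *)
Definition hausdorff_const (s : nat) : R :=
  (fine (lebesgue_rV s (cball s 1)) / 2 ^+ s)%R.

Definition hausdorff_gauge (s : nat) (E : set 'rV[R]_n) : \bar R :=
  if E == set0 then 0 else (hausdorff_const s)%:E * diameter E ^+ s.

Definition hausdorff_content (s : nat) (delta : R) (A : set 'rV[R]_n) : \bar R :=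
  ereal_inf [set r | exists E : nat -> set 'rV[R]_n,
    [/\ A `<=` \bigcup_k E k, forall k, diameter (E k) <= delta%:E
      & r = \sum_(k <oo) hausdorff_gauge s (E k)]].

Definition hausdorff_measure (s : nat) (A : set 'rV[R]_n) : \bar R :=
  ereal_sup [set hausdorff_content s delta A | delta in [set delta | (0 < delta)%R]].

End hausdorff.

Section smoothness.
Context {R : realType} {d : nat}.
Implicit Types (D : set 'rV[R]_d) (f : 'rV[R]_d -> R) (v t : 'rV[R]_d).

(* f is C^k on the closure D of an open set: f and its partial derivatives of
   order at most k, which exist on the interior of D, extend continuously to D;
   h is the i-th partial derivative together with its extension. *)
Fixpoint Ck (k : nat) D f : Prop :=
  {within D, continuous f} /\
  match k with
  | 0 => True
  | k'.+1 => forall i : 'I_d, exists h : 'rV[R]_d -> R,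
      (forall t, D° t -> is_derive t (delta_mx ord0 i : 'rV[R]_d) f (h t)) /\
      Ck k' D h
  end.

(* k-th derivative of f in the direction v; on the boundary of D it is the limit
   of its values in the interior of D, so that only f on D matters. *)
Definition dirderiv D (k : nat) v f t : R :=
  lim (iter k (fun h s => 'D_v h s) f @ within D° (nbhs t)).

Definition sup_norm D f : \bar R := ereal_sup [set `|f t|%:E | t in D].

End smoothness.

Section random.
Context {R : realType} {disp : measure_display} {Omega : measurableType disp}.
Variable P : probability Omega R.
Local Open Scope ereal_scope.

Definition independent_seq d' (T : measurableType d')
    (Y : nat -> {RV P >-> T}) : Prop :=
  forall (s : seq nat) (A : nat -> set T), uniq s ->
    (forall i, measurable (A i)) ->
    P (\bigcap_(i in [set` s]) (Y i @^-1` A i)) =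
    \prod_(i <- s) P (Y i @^-1` A i).

Definition identically_distributed d' (T : measurableType d')
    (Y : nat -> {RV P >-> T}) : Prop :=
  forall i j (A : set T), measurable A ->
    distribution P (Y i) A = distribution P (Y j) A.

Definition sigma_of_seq d' (T : measurableType d')
    (Y : nat -> {RV P >-> T}) : set (set Omega) :=
  <<s \bigcup_i preimage_set_system setT (Y i) measurable >>.

Definition independent_of d1 d2 (T1 : measurableType d1) (T2 : measurableType d2)
    (Y : nat -> {RV P >-> T1}) (Z : nat -> {RV P >-> T2}) : Prop :=
  forall E F, sigma_of_seq Y E -> sigma_of_seq Z F -> P (E `&` F) = P E * P F.

Definition npoints d (tau : nat -> {RV P >-> 'rV[R]_d}) (A : set 'rV[R]_d)
    (w : Omega) : \bar R :=
  \sum_(i <oo) (\1_A (tau i w))%:E.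

(* Poisson field on R^d with intensity lambda times Lebesgue measure; tau
   enumerates its points. *)
Definition poisson_field d (lambda : R) (tau : nat -> {RV P >-> 'rV[R]_d}) : Prop :=
  (forall (A : set 'rV[R]_d) (n : nat), measurable A -> lebesgue_rV d A < +oo ->
     let r := (lambda * fine (lebesgue_rV d A))%R in
     P [set w | npoints tau A w = n%:R%:E] =
     (expR (- r) * r ^+ n / n`!%:R)%R%:E) /\
  (forall (N : nat) (A : 'I_N -> set 'rV[R]_d) (n : 'I_N -> nat),
     (forall j, measurable (A j)) -> trivIset setT A ->
     P (\bigcap_(j : 'I_N) [set w | npoints tau (A j) w = (n j)%:R%:E]) =
     \prod_(j < N) P [set w | npoints tau (A j) w = (n j)%:R%:E]).

(* X is a shot noise field with kernel g: for each t, X t is almost surely the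
   sum of the series. *)
Definition shot_noise d (beta : nat -> {RV P >-> R})
    (tau : nat -> {RV P >-> 'rV[R]_d}) (g : 'rV[R]_d -> R)
    (X : 'rV[R]_d -> {RV P >-> R}) : Prop :=
  forall t, {ae P, forall w,
    (\sum_(0 <= i < n) (beta i w * g (t - tau i w)))%R @[n --> \oo] --> X t w}.

Definition is_density (Y : {RV P >-> R}) (f : R -> R) : Prop :=
  [/\ measurable_fun setT f, forall x, (0 <= f x)%R &
      forall A, measurable A ->
        distribution P Y A = \int[lebesgue_measure]_(x in A) (f x)%:E].

End random.

(* Main.v *)
Require Import Defs.
From HB Require Import structures.
From mathcomp Require Import all_boot all_order all_algebra.
From mathcomp Require Import all_classical all_reals all_analysis.
From mathcomp Require Import measurable_realfun lra ring zify.

(** Cover the ball by the cells of a cubic grid of mesh h, a constant over N.  The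
    (d - 1)-dimensional Hausdorff measure of the level set is at most a constant
    times the lower limit of N ^ (1 - d) times the number of cells which meet it.
    Such a cell is of one of three kinds.

    - Its neighbourhood leaves the open ball.  It lies in a shell of width O(h)
      around the sphere, and there are O(N ^ (d - 1)) such cells (card_shell).
    - The gradient is O(h) at a zero of X - u in the cell.  Then X - u is
      O(h ^ 2) at the corner of the cell, which has probability O(h ^ 2) since the
      density is bounded.  The expected number of such cells is of smaller order
      than N ^ (d - 1), even if the implied constant is allowed to grow slowly to
      overcome the random bound on second derivatives, and by Borel-Cantelli they
      are eventually too few to matter (crowded_negligible).
    - Otherwise the largest partial derivative, in direction j say, dominates the
      second-order error, and X - u vanishes at distance O(h) from the corner on
      the line through the corner in direction j (line_zero_or_near_critical).

    Grouping the cells of the third kind by lines, N ^ (1 - d) times their number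
    is a mean over the grid lines parallel to the axes of the number of zeros on
    the line (sum_setcoord, card_hit_cells).  This takes the place of Crofton's
    formula: an inequality is enough, and then so are the d directions of the
    axes.  By Jensen's inequality and Fatou's lemma it remains to bound the p-th
    moment of the number of zeros on one line, uniformly over lines
    (line_bound_integral).

    Cut the line into n intervals of length O(1 / n).  If one of them contains k
    zeros, then by Rolle's theorem |X - u| is at most a constant times
    n ^ (- k) L on all of it, where L bounds the k-th derivative in direction j
    (zeros_small), in particular at a point of the interval chosen in advance.
    So there are at most k n zeros, unless the k-th derivative exceeds L
    somewhere in the ball, which has probability O(L ^ (- m)), or |X - u| is that
    small at one of the n chosen points, which has probability
    O(n ^ (1 - k) L).  The choice L = n ^ ((k - 1) / (m + 1)) makes both equal to
    n ^ (- m (k - 1) / (m + 1)), and summing over n = 2 ^ r gives a finite p-th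
    moment as soon as p < m (k - 1) / (m + 1) (dyadic_bound_integral).  That
    range together with 1 <= p forces k > 2, which provides the second
    derivatives used above. *)

Set Implicit Arguments.
Unset Strict Implicit.
Unset Printing Implicit Defensive.

Import Order.TTheory GRing.Theory Num.Theory.
Import numFieldNormedType.Exports.

Local Open Scope classical_set_scope.
Local Open Scope ring_scope.

(** * Zeros of a function of one variable *)

Lemma itv_mem (R : realType) (I : set R) (x y z : R) : is_interval I ->
  I x -> I y -> z \in `[x, y] -> I z.
Proof. by move=> iI Ix Iy; rewrite in_itv/=; exact: iI. Qed.

Lemma within_continuous_itv (R : realType) (I : set R) (f df : R -> R) (x y : R) :
  is_interval I -> (forall z, I z -> is_derive z 1 f (df z)) -> I x -> I y ->
  {within `[x, y], continuous f}.
Proof.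
move=> iI fD Ix Iy; apply: derivable_within_continuous => z zxy.
by have [] := fD z (itv_mem iI Ix Iy zxy).
Qed.

(** One step of the descent from f to its k-th derivative: each of the gaps
    between consecutive zeros contributes one zero of the derivative.  The zeros
    are kept as a strictly increasing list headed by x, the form in which the
    step can be iterated. *)
Lemma rolle_zeros (R : realType) (I : set R) (f df : R -> R) (x : R) (s : seq R) :
  is_interval I -> (forall z, I z -> is_derive z 1 f (df z)) ->
  path <%R x s -> {in x :: s, forall z, I z /\ f z = 0} ->
  exists s', [/\ size s' = size s, path <%R x s' &
                 {in s', forall z, I z /\ df z = 0}].
Proof.
move=> iI fD; elim: s x => [|y s IH] x /=; first by exists [::].
move=> /andP[xy ys] H.
have [|s' [ss' ys' H']] := IH y ys; first by move=> z zs; apply: H; rewrite in_cons zs orbT.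
have [Ix fx] := H x (mem_head _ _).
have [Iy fy] : I y /\ f y = 0 by apply: H; rewrite !in_cons eqxx orbT.
have Ixy z : z \in `]x, y[ -> I z.
  by move=> zxy; apply: (itv_mem iI Ix Iy); exact: subset_itv_oo_cc zxy.
have fdv z : z \in `]x, y[ -> derivable f z 1 by move=> /Ixy /fD[].
have [|z zxy fz0] :=
  @Rolle R f x y xy fdv (within_continuous_itv iI fD Ix Iy); first by rewrite fx fy.
have Iz := Ixy z zxy.
move: (zxy); rewrite in_itv/= => /andP[xz zy].
exists (z :: s'); split => //=; first by rewrite ss'.
  rewrite xz /=; case: s' ys' {ss' H'} => //= t s' /andP[yt ->].
  by rewrite (lt_trans zy yt).
move=> t; rewrite in_cons => /orP[/eqP ->|]; last exact: H'.
split => //; have D1 := fD z Iz.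
by rewrite -(@derive_val _ _ _ _ _ _ _ D1) (@derive_val _ _ _ _ _ _ _ fz0).
Qed.

(** The mean value theorem with a reference slope G: the case G = 0 is the
    Lipschitz bound, and a slope close to df is what makes the expansions below
    accurate to second order. *)
Lemma taylor1_itv (R : realType) (I : set R) (f df : R -> R) (G M x y : R) :
  is_interval I -> (forall z, I z -> is_derive z 1 f (df z)) ->
  (forall z, I z -> `|df z - G| <= M) -> I x -> I y ->
  `|f y - f x - G * (y - x)| <= M * `|y - x|.
Proof.
move=> iI fD dM; wlog xy : x y / x <= y => [W Ix Iy|Ix Iy].
  have [xy|/ltW yx] := leP x y; first exact: W.
  rewrite (distrC y x).
  have -> : `|f y - f x - G * (y - x)| = `|f x - f y - G * (x - y)|.
    by rewrite -normrN; congr (`|_|); ring.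
  exact: W.
have [z zxy| z zxy ->] := @MVT_segment R f df x y xy _ (within_continuous_itv iI fD Ix Iy).
  by apply/fD/(itv_mem iI Ix Iy); exact: subset_itv_oo_cc zxy.
by rewrite -mulrBl normrM ler_wpM2r//; apply/dM/(itv_mem iI Ix Iy).
Qed.

(** Many zeros in a short interval force f to be small on all of it.  By
    repeated use of Rolle's theorem each derivative of order less than k vanishes
    somewhere in I; integrating k times from such zeros, every step gains a
    factor l. *)
Lemma zeros_small (R : realType) (I : set R) (F : nat -> R -> R) (k : nat)
    (l M : R) (s : seq R) :
  is_interval I -> 0 <= l ->
  (forall x y, I x -> I y -> `|x - y| <= l) ->
  (forall i z, (i < k)%N -> I z -> is_derive z 1 (F i) (F i.+1 z)) ->
  (forall z, I z -> `|F k z| <= M) ->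
  size s = k -> sorted <%R s -> {in s, forall z, I z /\ F 0 z = 0} ->
  forall x, I x -> `|F 0 x| <= l ^+ k * M.
Proof.
move=> iI l0 Il; elim: k F s => [|k IH] F s FD FM.
  by move=> _ _ _ x Ix; rewrite expr0 mul1r; exact: FM.
case: s => //= y s [sk] ys H x Ix.
have [s' [ss' ys' H']] := rolle_zeros iI (fun z => FD 0 z isT) ys H.
have sF1 z : I z -> `|F 1 z - 0| <= l ^+ k * M.
  rewrite subr0; apply: (IH (fun i => F i.+1) s') => //.
  - by move=> i t ik; exact: FD.
  - by rewrite ss'.
  - exact: path_sorted ys'.
have [Iy Fy] := H y (mem_head _ _).
have := taylor1_itv iI (fun z => FD 0 z isT) sF1 Iy Ix.
rewrite Fy mul0r !subr0 => /le_trans; apply.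
rewrite exprSr -(mulrA _ l) (mulrC l) mulrA ler_wpM2l //; last exact: Il.
exact: le_trans (normr_ge0 _) (sF1 x Ix).
Qed.

(** * Counting cells of a cubic grid *)

Lemma card_bigcup_le (T : finType) (n : nat) (F : 'I_n -> {set T}) :
  (#|(\bigcup_(r < n) F r)%SET| <= \sum_(r < n) #|F r|)%N.
Proof.
elim/big_ind2 : _ => //[|A m B l Am Bl]; first by rewrite cards0.
by rewrite (leq_trans (leq_card_setU _ _))// leq_add.
Qed.

Lemma card_spread (N D : nat) (A : {set 'I_N}) :
  {in A &, forall i j : 'I_N, (i <= j + D)%N} -> (#|A| <= D.+1)%N.
Proof.
move=> AD; have [->|[i0 i0A]] := set_0Vmem A; first by rewrite cards0.
case: (arg_minnP (fun i : 'I_N => i : nat) i0A) => m mA mmin.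
have inj : {in A &, injective (fun i : 'I_N => inord (i - m) : 'I_D.+1)}.
  move=> i j iA jA /(congr1 (fun x : 'I__ => x : nat)) /=.
  have := AD i m iA mA; have := AD j m jA mA.
  have := mmin i iA; have := mmin j jA => /= m1 m2 a1 a2.
  by rewrite !inordK => [e||]; [apply/val_inj => /=|..]; lia.
by rewrite -(card_in_imset inj) (leq_trans (max_card _))// card_ord.
Qed.

(** When every fibre of f is contained in D + 1 consecutive indices, counting
    indices amounts to counting values of f up to the factor D + 1. *)
Lemma card_fibers (N D : nat) (T : eqType) (f : 'I_N -> T) (A : {set 'I_N}) :
  {in A &, forall i j : 'I_N, f i = f j -> (i <= j + D)%N} ->
  (#|A| <= size (undup [seq f i | i in A]) * D.+1)%N.
Proof.
move=> AD; set s := undup _.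
have -> : #|A| = (\sum_(y <- s) #|[set i in A | f i == y]%SET|)%N.
  under eq_bigr => y _ do rewrite -sum1_card big_mkcond /=.
  rewrite exchange_big /= -sum1_card [LHS]big_mkcond; apply: eq_bigr => i _ /=.
  case: ifPn => iA; last by rewrite big1// => y _; rewrite inE (negPf iA).
  have fs : f i \in s by rewrite mem_undup; apply/mapP; exists i; rewrite ?mem_enum.
  rewrite (bigD1_seq (f i))//= ?undup_uniq// inE iA eqxx/= big1 ?addn0//.
  by move=> y yf; rewrite inE iA /= eq_sym (negPf yf).
rewrite -[size s]sum1_size big_distrl/=; apply: leq_sum => y _; rewrite mul1n.
apply: card_spread => i j; rewrite !inE => /andP[iA /eqP fi] /andP[jA /eqP fj].
by apply: AD => //; rewrite fi fj.
Qed.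

Definition cells (d N : nat) := {ffun 'I_d -> 'I_N}.

Definition setcoord (d N : nat) (z : cells d N) (j : 'I_d) (i : 'I_N) : cells d N :=
  [ffun l => if l == j then i else z l].

(** Double counting: replacing the j-th index of z by i and remembering the old
    one is an involution of pairs (z, i).  It turns the number of cells of S into
    a mean, over all z, of the number of cells of S on the line through z in
    direction j. *)
Lemma sum_setcoord (d N : nat) (j : 'I_d) (S : {set cells d N}) :
  (\sum_(z : cells d N) #|[set i | setcoord z j i \in S]%SET| = N * #|S|)%N.
Proof.
rewrite (eq_bigr (fun z => \sum_(i : 'I_N) (setcoord z j i \in S : nat))%N); last first.
  move=> z _; rewrite -sum1_card big_mkcond /=.
  by apply: eq_bigr => i _; rewrite inE; case: ifP.
rewrite pair_bigA /=.
pose h (p : cells d N * 'I_N) := (setcoord p.1 j p.2, p.1 j).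
have hK : involutive h.
  move=> [z i]; rewrite /h /=; congr pair.
    by apply/ffunP => l; rewrite !ffunE; case: eqP => [->|].
  by rewrite ffunE eqxx.
rewrite (reindex_inj (inv_inj hK)) /=.
rewrite (eq_bigr (fun p : cells d N * 'I_N => (p.1 \in S : nat))%N); last first.
  move=> p _; congr (nat_of_bool (_ \in S)).
  by case: p => z i; have := hK (z, i) => -[].
rewrite -(pair_bigA _ (fun (z : cells d N) (i : 'I_N) => (z \in S : nat))%N) /=.
under eq_bigr do rewrite sum_nat_const card_ord.
rewrite -big_distrr/= -sum1_card [in RHS]big_mkcond/=.
by congr (_ * _)%N; apply: eq_bigr => z _; case: ifP.
Qed.

Section grid.
Context {R : realType} (a : R).

(** The grid lives in the cube [-2a, 2a)^d, twice as wide as the ball, so that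
    points on the boundary of the ball need no special treatment. *)
Definition mesh (N : nat) : R := 4 * a / N%:R.

Definition grid (N i : nat) : R := - (2 * a) + i%:R * mesh N.

Definition corner (d N : nat) (z : cells d N) : 'rV[R]_d := \row_i grid N (z i).

Definition sqn (d : nat) (x : 'rV[R]_d) : R := \sum_(i < d) x ord0 i ^+ 2.

Hypothesis a0 : 0 < a.

Lemma mesh_gt0 N : (0 < N)%N -> 0 < mesh N.
Proof. by move=> N0; rewrite /mesh divr_gt0 ?ltr0n// mulr_gt0. Qed.

(** Where |s| is at least rho, the function s ^ 2 grows at rate at least 2 rho on
    each side of the origin, so that a window of width O(mesh) for its values
    leaves room for boundedly many grid points on each side. *)
Lemma grid_line_shell (N : nat) (A : {set 'I_N}) (D : nat) (K rho c : R) :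
  0 < rho -> K <= D%:R * rho ->
  {in A, forall i : 'I_N, `|grid N i ^+ 2 + c| <= K * mesh N /\ rho ^+ 2 <= grid N i ^+ 2} ->
  (#|A| <= 2 * D.+1)%N.
Proof.
move=> rho0 KD HA.
have [->|[i0 i0A]] := set_0Vmem A; first by rewrite cards0.
have N0 : (0 < N)%N by case: i0 {i0A} => i0; case: (N).
have h0 := mesh_gt0 N0.
have := @card_fibers N D _ (fun i : 'I_N => 0 <= grid N i) A.
(* The fibres are the two half-lines, told apart by the sign. *)
set s := undup _ => H; have {}H := H _; apply: leq_trans; first apply: H.
  move=> i j iA jA sij; have [qi ri] := HA i iA; have [qj rj] := HA j jA.
  have [ij|ij] := leqP i j; first by rewrite (leq_trans ij)// leq_addr.
  rewrite -leq_subLR -(ler_nat R) natrB ?(ltnW ij)//.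
  have dE : (i%:R - j%:R) * mesh N = grid N i - grid N j by rewrite /grid; ring.
  have key : (grid N i - grid N j) * rho <= K * mesh N.
    have gij : 0 < grid N i - grid N j.
      by rewrite -dE mulr_gt0// subr_gt0 ltr_nat.
    have [gi|gi] := leP 0 (grid N i).
      have gj : 0 <= grid N j by rewrite -sij.
      have gi' : rho <= grid N i by rewrite -(ler_pXn2r (n:=2))// ?nnegrE ltW.
      have gj' : rho <= grid N j by rewrite -(ler_pXn2r (n:=2))// ?nnegrE ltW.
      move: qi qj; rewrite !ler_norml => /andP[_ qi] /andP[qj _]; nra.
    have gj : grid N j < 0 by rewrite ltNge -sij -ltNge.
    have gi' : rho <= - grid N i.
      by rewrite -(ler_pXn2r (n:=2))// ?nnegrE ?sqrrN// ltW// oppr_gt0.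
    have gj' : rho <= - grid N j.
      by rewrite -(ler_pXn2r (n:=2))// ?nnegrE ?sqrrN// ltW// oppr_gt0.
    move: qi qj; rewrite !ler_norml => /andP[qi _] /andP[_ qj]; nra.
  rewrite -dE mulrAC ler_pM2r// in key.
  by rewrite -(ler_pM2r rho0) (le_trans key).
have uss : (size s <= size [:: true; false])%N.
  by apply: uniq_leq_size; [exact: undup_uniq|case].
by rewrite leq_mul2r uss orbT.
Qed.

Lemma corner_setcoord (d N : nat) (z : cells d N) (j : 'I_d) (i : 'I_N) :
  sqn (corner (setcoord z j i)) =
  grid N i ^+ 2 + \sum_(l < d | l != j) grid N (z l) ^+ 2.
Proof.
rewrite /sqn (bigD1 j)//= mxE ffunE eqxx; congr +%R.
by apply: eq_bigr => l lj; rewrite mxE ffunE (negPf lj).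
Qed.

(** A thin spherical shell meets a line transversally only if the line is not
    nearly tangent to the sphere.  Each point of the shell has one coordinate of
    size at least rho, and the line through it in the direction of that
    coordinate is transversal: grid_line_shell applies to it. *)
Lemma card_shell (d N : nat) (S : {set cells d N}) (D : nat) (K rho : R) :
  0 < rho -> K <= D%:R * rho -> K * mesh N + d%:R * rho ^+ 2 <= a ^+ 2 ->
  {in S, forall z, `|sqn (corner z) - a ^+ 2| <= K * mesh N} -> (0 < d)%N ->
  (N * #|S| <= \sum_(j < d) \sum_(z : cells d N) 2 * D.+1)%N.
Proof.
move=> rho0 KD Kh HS d0.
pose Sj j := [set z in S | rho ^+ 2 <= grid N (z j) ^+ 2]%SET.
have SS : (#|S| <= \sum_(j < d) #|Sj j|)%N.
  have sub : S \subset (\bigcup_(j < d) Sj j)%SET.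
    apply/fintype.subsetP => z zS; apply/finset.bigcupP.
    suff [j jr] : exists j : 'I_d, rho ^+ 2 <= grid N (z j) ^+ 2.
      by exists j => //; rewrite inE zS.
    apply: contrapT => /forallNP nj; have := HS z zS.
    rewrite ler_norml => /andP[+ _]; rewrite leNgt => /negP; apply.
    suff : sqn (corner z) < d%:R * rho ^+ 2 by lra.
    have -> : d%:R * rho ^+ 2 = \sum_(j < d) rho ^+ 2.
      by rewrite sumr_const card_ord mulr_natl.
    apply: ltr_sum; first by apply/hasP; exists (Ordinal d0); rewrite ?mem_index_enum.
    by move=> j _; rewrite mxE ltNge; apply/negP/nj.
  exact: leq_trans (subset_leq_card sub) (card_bigcup_le _).
rewrite (leq_trans (leq_mul (leqnn N) SS))// big_distrr/=; apply: leq_sum => j _.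
rewrite -(sum_setcoord j); apply: leq_sum => z _.
apply: (@grid_line_shell _ _ _ K rho
  (\sum_(l < d | l != j) grid N (z l) ^+ 2 - a ^+ 2)) => // i.
rewrite !inE => /andP[zS]; rewrite ffunE eqxx => ->; split=> //.
by rewrite addrA -corner_setcoord; exact: HS.
Qed.

Definition cellidx (N : nat) (s : R) : nat := Num.truncn ((s + 2 * a) / mesh N).

Lemma cellidxP N s : (0 < N)%N -> `|s| <= a ->
  (cellidx N s < N)%N /\ grid N (cellidx N s) <= s <= grid N (cellidx N s) + mesh N.
Proof.
move=> N0; rewrite ler_norml => /andP[s1 s2]; have h0 := mesh_gt0 N0.
have s0 : 0 <= (s + 2 * a) / mesh N.
  by rewrite divr_ge0 ?(ltW h0)//; lra.
have /andP[t1 t2] := truncn_itv s0.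
rewrite -/(cellidx N s) in t1 t2.
rewrite ler_pdivlMr// in t1; rewrite ltr_pdivrMr// in t2.
split.
  rewrite -(ltr_nat R) -(ltr_pM2r h0) (le_lt_trans t1)//.
  by rewrite /mesh (mulrC N%:R) divfK ?pnatr_eq0 -?lt0n//; have := a0; lra.
rewrite /grid; move: t2; rewrite -natr1 mulrDl mul1r; lra.
Qed.

End grid.

(** * First-order expansion along coordinate directions *)

Section coordinates.
Context {R : realType} {d : nat}.
Implicit Types (x y t p : 'rV[R]_d) (f : 'rV[R]_d -> R).

Definition unit_vec (j : 'I_d) : 'rV[R]_d := delta_mx ord0 j.

(** The two difference quotients are the same function, since
    x + (h + s) v = h v + (x + s v). *)
Lemma is_derive_line f (df : R) x (v : 'rV[R]_d) (s : R) :
  is_derive (x + s *: v) v f df -> is_derive s 1 (fun r => f (x + r *: v)) df.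
Proof.
have E : (fun h : R => h^-1 *: (f (x + (h *: (1 : R) + s) *: v) - f (x + s *: v))) =
         (fun h : R => h^-1 *: (f (h *: v + (x + s *: v)) - f (x + s *: v))).
  apply/funext => h; congr (_ *: (f _ - _)).
  have -> : h *: (1 : R) = h by exact: mulr1.
  by rewrite scalerDl addrCA.
case=> fd fv; split; first by move: fd; rewrite /derivable /= -E.
by rewrite -fv /derive /= -E.
Qed.

Definition box x (r : R) : set 'rV[R]_d :=
  [set y | forall i, `|y ord0 i - x ord0 i| <= r].

Lemma line_box_interval x r p (j : 'I_d) :
  is_interval [set s | box x r (p + s *: unit_vec j)].
Proof.
move=> s t bs bt z /andP[sz zt] i; have := bs i; have := bt i.
rewrite /unit_vec !mxE !ler_norml /=; case: (_ == _) => /=; rewrite ?mulr1 ?mulr0; lra.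
Qed.

(** The increment from t to y is split along a path which changes one coordinate
    at a time.  Only partial derivatives enter, hence no differentiability of f
    as a function of several variables has to be established; the path stays
    in the box, which is why boxes are used here instead of balls. *)
Lemma taylor1_box x (r : R) f (g : 'I_d -> 'rV[R]_d -> R) (G : 'I_d -> R) (M : R) t y :
  (forall p i, box x r p -> is_derive p (unit_vec i) f (g i p)) ->
  (forall p i, box x r p -> `|g i p - G i| <= M) ->
  box x r t -> box x r y ->
  `|f y - f t - \sum_i G i * (y ord0 i - t ord0 i)| <=
  M * \sum_i `|y ord0 i - t ord0 i|.
Proof.
move=> fD gM bt by_.
pose p (l : nat) : 'rV[R]_d := \row_i (if (i < l)%N then y ord0 i else t ord0 i).
have bp l : box x r (p l) by move=> i; rewrite mxE; case: ifP.
have p0 : p 0 = t by apply/rowP => i; rewrite mxE.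
have pd : p d = y by apply/rowP => i; rewrite mxE ltn_ord.
have pS (l : 'I_d) : p l.+1 = p l + (y ord0 l - t ord0 l) *: unit_vec l.
  apply/rowP => i; rewrite /unit_vec !mxE eqxx /= ltnS leq_eqVlt -val_eqE /=.
  by case: ltngtP => il /=; rewrite ?mulr0 ?addr0// mulr1 (val_inj il); ring.
have -> : f y - f t = \sum_(l < d) (f (p l.+1) - f (p l)).
  by rewrite -(big_mkord xpredT (fun l => f (p l.+1) - f (p l))) telescope_sumr// p0 pd.
rewrite -sumrB (le_trans (ler_norm_sum _ _ _))// mulr_sumr ler_sum// => l _.
have := @taylor1_itv R [set s | box x r (p l + s *: unit_vec l)]
  (fun s => f (p l + s *: unit_vec l)) (fun s => g l (p l + s *: unit_vec l))
  (G l) M 0 (y ord0 l - t ord0 l).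
rewrite -pS scale0r addr0 subr0; apply.
- exact: line_box_interval.
- by move=> z bz; apply: is_derive_line; exact: fD.
- by move=> z bz; exact: gM.
- by rewrite /= scale0r addr0.
- by rewrite /= -pS.
Qed.

Lemma le_box x (r r' : R) t : r <= r' -> box x r t -> box x r' t.
Proof. by move=> rr bt i; rewrite (le_trans (bt i)). Qed.

Lemma box_line x (j : 'I_d) (s r : R) : `|s| <= r -> box x r (x + s *: unit_vec j).
Proof.
move=> sr i; rewrite /unit_vec !mxE addrAC subrr add0r /=.
by case: (_ == _); rewrite /= ?mulr1// mulr0 normr0 (le_trans _ sr).
Qed.

Lemma sum_dist_box x y (r : R) : box x r y ->
  \sum_i `|y ord0 i - x ord0 i| <= d%:R * r.
Proof.
move=> b; rewrite (le_trans (ler_sum _ (fun i _ => b i)))//.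
by rewrite sumr_const card_ord mulr_natl.
Qed.

(** Let t be a zero of f in the cell at x, j the direction of the largest partial
    derivative at t and G its size.  Moving from x by (d + 1) h in the two
    directions along the j-th axis changes f by (d + 1) h G, while the
    displacement from t to x accounts for at most d h G.  If the remaining h G
    exceeds the second-order error, f changes sign between the two ends and
    vanishes in between; if not, G = O(h) and f is O(h ^ 2) at x. *)
Lemma line_zero_or_near_critical x (h : R) f (g : 'I_d -> 'rV[R]_d -> R)
    (gg : 'I_d -> 'I_d -> 'rV[R]_d -> R) (M : R) t :
  (0 < d)%N -> 0 < h ->
  (forall p i, box x (d.+1%:R * h) p -> is_derive p (unit_vec i) f (g i p)) ->
  (forall p i l, box x (d.+1%:R * h) p -> is_derive p (unit_vec l) (g i) (gg i l p)) ->
  (forall p i l, box x (d.+1%:R * h) p -> `|gg i l p| <= M) ->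
  box x h t -> f t = 0 ->
  (exists j s, `|s| <= d.+1%:R * h /\ f (x + s *: unit_vec j) = 0) \/
  `|f x| <= 2 * d%:R ^+ 2 * d.+1%:R * d.+2%:R * M * h ^+ 2.
Proof.
move=> d0 h0; set r := d.+1%:R * h => fD gD ggM bt ft0.
have hr : h <= r by rewrite /r ler_peMl ?(ltW h0)// ler1n.
have r0 : 0 <= r by rewrite (le_trans _ hr) ?ltW.
have btr := le_box hr bt.
have bx : box x r x by move=> i; rewrite subrr normr0.
have M0 : 0 <= M.
  by rewrite (le_trans _ (ggM x (Ordinal d0) (Ordinal d0) bx)).
(* Bound for the variation of the partial derivatives over the box, whose points
   are at distance at most (d + 2) h from t in each coordinate. *)
set eta := M * (d%:R * (d.+2%:R * h)).
have eta0 : 0 <= eta by rewrite /eta !mulr_ge0// ltW.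
have gt p i : box x r p -> `|g i p - g i t| <= eta.
  move=> bp; have ggM0 q l : box x r q -> `|gg i l q - 0| <= M.
    by rewrite subr0; exact: ggM.
  have := taylor1_box (fun q l => @gD q i l) ggM0 btr bp.
  rewrite big1 ?subr0 => [H|l _]; last by rewrite mul0r.
  rewrite (le_trans H)//.
  rewrite ler_wpM2l//.
  have : box t (d.+2%:R * h) p.
    move=> l; rewrite -(subrKA (x ord0 l)) (le_trans (ler_normD _ _))//.
    by rewrite -natr1 mulrDl mul1r lerD// distrC; exact: bt.
  exact: sum_dist_box.
have [j _ jmax] := @arg_maxP _ _ _ (Ordinal d0) xpredT (fun i => `|g i t|) isT.
pose G : R := `|g j t|.
have {}jmax i : `|g i t| <= G by exact: jmax.
have sumG (v : 'I_d -> R) : (forall i, `|v i| <= h) ->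
    `|\sum_i g i t * v i| <= d%:R * (G * h).
  move=> vh; rewrite (le_trans (ler_norm_sum _ _ _))//.
  rewrite (_ : d%:R * _ = \sum_(i < d) G * h); last first.
    by rewrite sumr_const card_ord mulr_natl.
  by apply: ler_sum => i _; rewrite normrM ler_pM.
have tx i : `|x ord0 i - t ord0 i| <= h by rewrite distrC; exact: bt.
have [Gbig|Gsmall] := leP (eta * (2 * d%:R + 1)) G; last first.
  right; have := @taylor1_box x r f g (g^~ t) eta t x fD.
  move=> /(_ (fun p i => gt p i) btr bx); rewrite ft0 subr0.
  have := sumG _ tx.
  have : \sum_i `|x ord0 i - t ord0 i| <= d%:R * h.
    rewrite (le_trans (ler_sum _ (fun i _ => tx i)))//.
    by rewrite sumr_const card_ord mulr_natl.
  set S := \sum_i _; set T := \sum_i _ => SB TB H.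
  have {H} : `|f x| <= d%:R * (G * h) + eta * (d%:R * h).
    have : `|f x| <= `|f x - T| + `|T|.
      by rewrite -{1}(subrK T (f x)) ler_normD.
    have : eta * S <= eta * (d%:R * h) by rewrite ler_wpM2l.
    lra.
  move=> /le_trans; apply.
  have : d%:R * (G * h) <= d%:R * (eta * (2 * d%:R + 1) * h).
    by rewrite ler_wpM2l// ler_wpM2r// ltW.
  suff -> : 2 * d%:R ^+ 2 * d.+1%:R * d.+2%:R * M * h ^+ 2 =
     d%:R * (eta * (2 * d%:R + 1) * h) + eta * (d%:R * h) by lra.
  by rewrite /eta -[d.+2%:R]natr1 -[d.+1%:R]natr1; ring.
left; exists j.
pose F s := f (x + s *: unit_vec j).
pose I := [set s | box x r (x + s *: unit_vec j)].
have iI : is_interval I by exact: line_box_interval.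
have Is s : `|s| <= r -> I s by move=> sr; exact: box_line.
have FD s : I s -> is_derive s 1 F (g j (x + s *: unit_vec j)).
  by move=> Is'; apply: is_derive_line; exact: fD.
have est s : `|s| = r -> `|F s - s * g j t| <= d%:R * (G * h) + eta * ((2 * d%:R + 1) * h).
  move=> sr; have bs : box x r (x + s *: unit_vec j) by apply: Is; rewrite sr.
  have := taylor1_box fD (fun p i => @gt p i) btr bs; rewrite ft0 subr0.
  have yE i : (x + s *: unit_vec j) ord0 i - t ord0 i =
      (x ord0 i - t ord0 i) + s * (i == j)%:R.
    by rewrite /unit_vec !mxE eqxx /= addrAC.
  under eq_bigr do rewrite yE mulrDr.
  under [in X in _ <= X]eq_bigr do rewrite yE.
  rewrite big_split/=.
  have -> : \sum_(i < d) g i t * (s * (i == j)%:R) = s * g j t.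
    rewrite (bigD1 j)//= eqxx mulr1 big1 ?addr0 1?mulrC// => i /negPf ->.
    by rewrite !mulr0.
  have := sumG _ tx; set T := \sum_i _; set S := \sum_i _ => TB H.
  have SB : S <= (2 * d%:R + 1) * h.
    have -> : (2 * d%:R + 1) * h = d%:R * h + r by rewrite /r -[d.+1%:R]natr1; ring.
    have -> : d%:R * h + r = \sum_(i < d) (h + `|s| * (i == j)%:R).
      rewrite big_split/= sumr_const card_ord mulr_natl; congr +%R.
      rewrite (bigD1 j)//= eqxx mulr1 big1 ?addr0// => i /negPf ->.
      by rewrite mulr0.
    apply: ler_sum => i _; rewrite (le_trans (ler_normD _ _))// lerD//.
    by rewrite normrM normr_nat.
  have : `|F s - s * g j t| <= `|f (x + s *: unit_vec j) - (T + s * g j t)| + `|T|.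
    rewrite -[X in `|X| <= _](subrK T) (le_trans (ler_normD _ _))// lerD2r.
    by rewrite /F opprD addrA addrAC.
  have : eta * S <= eta * ((2 * d%:R + 1) * h) by rewrite ler_wpM2l.
  lra.
have Gh : d%:R * (G * h) + eta * ((2 * d%:R + 1) * h) <= r * G.
  have : eta * (2 * d%:R + 1) * h <= G * h by rewrite ler_wpM2r// ltW.
  by rewrite /r -[d.+1%:R]natr1; lra.
have rN : `|- r| = r by rewrite normrN ger0_norm.
have rr : `|r| = r by rewrite ger0_norm.
have /(@IVT R F (- r) r 0) : - r <= r by rewrite ge0_cp.
case.
- apply: (within_continuous_itv iI FD); apply: Is; first by rewrite rN.
  by rewrite rr.
- have := est _ rN; have := est _ rr; move: Gh; rewrite /G.
  rewrite ge_min le_max !ler_norml.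
  case: (lerP 0 (g j t)) => g0.
    rewrite (ger0_norm g0) => Gh /andP[e1 e2] /andP[e3 e4].
    have -> : F (- r) <= 0 by lra.
    by have -> : 0 <= F r; [lra|rewrite orbT].
  rewrite (ltr0_norm g0) => Gh /andP[e1 e2] /andP[e3 e4].
  have -> : F r <= 0 by lra.
  by have -> : 0 <= F (- r); [lra|rewrite orbT].
move=> s; rewrite in_itv/= => sr Fs; exists s; split => //.
by rewrite ler_norml.
Qed.

End coordinates.

(** * The ball and the iterated derivatives of a smooth function on it *)

Section ball.
Context {R : realType} {d : nat} (a : R).
Hypothesis a0 : 0 < a.

Definition oball : set 'rV[R]_d := [set t | sqn t < a ^+ 2].

Lemma sqn_ge0 (t : 'rV[R]_d) : 0 <= sqn t.
Proof. by apply: sumr_ge0 => i _; exact: sqr_ge0. Qed.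

Lemma cballE : cball d a = [set t | sqn t <= a ^+ 2].
Proof.
apply/seteqP; split => t; rewrite /cball /enorm /= -/(sqn t).
  move=> h; rewrite -(sqr_sqrtr (sqn_ge0 t)) ler_pXn2r// ?nnegrE ?sqrtr_ge0//.
  exact: ltW.
by move=> h; rewrite -(ger0_norm (ltW a0)) -sqrtr_sqr ler_sqrt// sqr_ge0.
Qed.

Lemma sqn_continuous : continuous (@sqn R d).
Proof.
rewrite /sqn; apply: (@continuous_big _ _ +%R 0).
  exact: add_continuous.
move=> i _ t; apply: (@continuous_comp _ _ _ (fun x : 'rV[R]_d => x ord0 i)
  (fun r : R => r ^+ 2)); first exact: coord_continuous.
exact: exprn_continuous.
Qed.

Lemma oball_open : open oball.
Proof.
rewrite (_ : oball = @sqn R d @^-1` [set r : R | r < a ^+ 2])//.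
by apply: open_comp => [t _|]; [exact: sqn_continuous|exact: open_lt].
Qed.

Lemma oball_cball : oball `<=` cball d a.
Proof. by rewrite cballE => t /= /ltW. Qed.

Lemma oball_interior : oball `<=` (cball d a)°.
Proof. by rewrite -open_subsetE; [exact: oball_cball|exact: oball_open]. Qed.

Lemma coord_le (t : 'rV[R]_d) i : sqn t <= a ^+ 2 -> `|t ord0 i| <= a.
Proof.
move=> ta; rewrite -(ler_pXn2r (n:=2))// ?nnegrE ?(ltW a0)//.
rewrite real_normK ?num_real// (le_trans _ ta)// /sqn (bigD1 i)//= lerDl.
by apply: sumr_ge0 => j _; exact: sqr_ge0.
Qed.

Lemma cball_compact : compact (cball d a).
Proof.
have C : compact [set v : 'rV[R]_d | forall i, v ord0 i \in `[(- a), a]].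
  apply: (@rV_compact _ _ (fun=> `[(- a), a]%classic)).
  by move=> _; exact: segment_compact.
apply: (subclosed_compact _ C); rewrite cballE.
  rewrite (_ : [set _ | _] = @sqn R d @^-1` [set r : R | r <= a ^+ 2])//.
  by apply: closed_comp => [t _|]; [exact: sqn_continuous|exact: closed_le].
by move=> t /= ta i; rewrite in_itv/= -ler_norml; exact: coord_le.
Qed.

End ball.

Section smooth.
Context {R : realType} {d : nat} (D : set 'rV[R]_d).
Implicit Types (f : 'rV[R]_d -> R) (t : 'rV[R]_d).

Lemma within_compact_bounded f : compact D -> {within D, continuous f} ->
  exists M : R, forall t, D t -> `|f t| <= M.
Proof.
move=> cD cf; have /compact_bounded [M [_ Mf]] := continuous_compact cf cD.
by exists (M + 1) => t Dt; apply: (Mf (M + 1)); [rewrite ltrDl|exists t].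
Qed.

Lemma within_continuous_interior f t : {within D, continuous f} -> D° t ->
  f s @[s --> t] --> f t.
Proof.
move=> cf Dt.
have := continuous_subspaceW (@interior_subset _ D) cf.
rewrite continuous_open_subspace; last exact: open_interior.
by move=> /(_ t); apply; rewrite inE.
Qed.

Lemma Ck_within k f : Ck k D f -> {within D, continuous f}.
Proof. by case: k => [|k] []. Qed.

Lemma Ck_second_partials k f : compact D -> (2 <= k)%N -> Ck k D f ->
  exists g gg M, [/\
    forall t i, D° t -> is_derive t (unit_vec i) f (g i t),
    forall t i l, D° t -> is_derive t (unit_vec l) (g i) (gg i l t) &
    forall t i l, D t -> `|gg i l t| <= M].
Proof.
move=> cD; case: k => [//|[//|k]] _ /= [_ /choice[g Hg]].
have /choice[gg Hgg] i : exists gg : 'I_d -> 'rV[R]_d -> R, forall l,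
    (forall t, D° t -> is_derive t (unit_vec l) (g i) (gg l t)) /\
    {within D, continuous (gg l)}.
  have [_ [_ /choice[gg Hgg]]] := Hg i; exists gg => l.
  by have [Hl /Ck_within] := Hgg l.
have /choice[M HM] (p : 'I_d * 'I_d) : exists M, forall t, D t -> `|gg p.1 p.2 t| <= M.
  by apply: within_compact_bounded => //; exact: (Hgg _ _).2.
exists g, gg, (\sum_p `|M p|); split.
- by move=> t i Dt; exact: (Hg i).1.
- by move=> t i l Dt; exact: (Hgg i l).1.
move=> t i l Dt; rewrite (le_trans (HM (i, l) t Dt))// (le_trans (ler_norm _))//.
by rewrite (bigD1 (i, l))//= lerDl sumr_ge0.
Qed.

(** The definition of C^k supplies, at each order, some function which is the
    partial derivative; iterating it in a fixed direction gives a chain of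
    successive derivatives. *)
Lemma Ck_dir k f (j : 'I_d) : Ck k D f -> exists H : nat -> 'rV[R]_d -> R,
  [/\ H 0 = f, forall i t, (i < k)%N -> D° t ->
    is_derive t (unit_vec j) (H i) (H i.+1 t) & {within D, continuous (H k)}].
Proof.
elim: k f => [|k IH] f /= [cf]; first by exists (fun=> f).
move=> /(_ j)[h [Hh /IH[H [H0 HD Hc]]]].
exists (fun i => if i is i'.+1 then H i' else f); split => // -[|i] t ik Dt.
  by rewrite H0; exact: Hh.
exact: HD.
Qed.

Definition dderiv (j : 'I_d) i f : 'rV[R]_d -> R :=
  iter i (fun h s => 'D_(unit_vec j) h s) f.

Lemma iter_dir k f (j : 'I_d) H : H 0%N = f ->
  (forall i t, (i < k)%N -> D° t ->
    is_derive t (unit_vec j) (H i) (H i.+1 t)) ->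
  forall i t, (i <= k)%N -> D° t -> dderiv j i f t = H i t.
Proof.
move=> H0 HD; elim => [|i IH] t ik Dt; first by rewrite /= H0.
rewrite /= (@near_eq_derive _ _ _ _ (H i)).
  exact: (@derive_val _ _ _ _ _ _ _ (HD i t ik Dt)).
have := open_nbhs_nbhs (conj (@open_interior _ D) Dt).
by apply: filterS => s Ds; apply: IH => //; exact: ltnW.
Qed.

(** In the interior the chain of Ck_dir coincides with the iterated directional
    derivatives, because a derivative depends only on the values near the
    point.  The directional derivative in the sense of limits from the interior
    is then the ordinary one, by continuity of the last term of the chain. *)
Lemma Ck_dderiv k f (j : 'I_d) : Ck k D f ->
  [/\ forall i t, (i < k)%N -> D° t ->
     is_derive t (unit_vec j) (dderiv j i f) (dderiv j i.+1 f t),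
   forall t, D° t -> dderiv j k f s @[s --> t] --> dderiv j k f t &
   forall t, D° t -> dirderiv D k (unit_vec j) f t = dderiv j k f t].
Proof.
move=> /(Ck_dir j)[H [H0 HD Hc]]; have E := iter_dir H0 HD.
have near_D t : D° t -> \near t, D° t.
  by move=> Dt; exact: open_nbhs_nbhs (conj (@open_interior _ D) Dt).
have cvgk t : D° t -> dderiv j k f s @[s --> t] --> dderiv j k f t.
  move=> Dt; rewrite E//; apply: cvg_trans (within_continuous_interior Hc Dt).
  apply: (@near_eq_cvg _ _ _ (nbhs_filter t)).
  by apply: filterS (near_D t Dt) => s Ds; rewrite E.
split=> //.
  move=> i t ik Dt; rewrite E//; apply: near_eq_is_derive (HD i t ik Dt).
  by apply: filterS (near_D t Dt) => s Ds; rewrite E// ltnW.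
move=> t Dt; rewrite /dirderiv within_interior; last first.
  by rewrite (interior_id _).1 //; exact: open_interior.
by apply: cvg_lim => //; exact: cvgk.
Qed.

End smooth.

(** * Covering a level set by grid cells *)

Section hausdorff_bound.
Context {R : realType} {d : nat}.
Local Open Scope ereal_scope.

Lemma hausdorff_const_ge0 s : (0 <= hausdorff_const s :> R)%R.
Proof. by rewrite /hausdorff_const divr_ge0// fine_ge0. Qed.

Lemma diameter_ge0 (E : set 'rV[R]_d) : 0 <= diameter E.
Proof. by apply: ereal_sup_ubound; left. Qed.

Lemma diameter_le (E : set 'rV[R]_d) (r : R) : (0 <= r)%R ->
  (forall x y, E x -> E y -> enorm (x - y) <= r)%R -> diameter E <= r%:E.
Proof.
move=> r0 Er; apply: ge_ereal_sup => _ [->|[x [y [Ex Ey ->]]]].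
  by rewrite lee_fin.
by rewrite lee_fin; exact: Er.
Qed.

Lemma hausdorff_gauge_ge0 s (E : set 'rV[R]_d) : 0 <= hausdorff_gauge s E.
Proof.
rewrite /hausdorff_gauge; case: ifPn => // _.
by rewrite mule_ge0 ?lee_fin ?hausdorff_const_ge0// expe_ge0// diameter_ge0.
Qed.

Lemma hausdorff_gauge_le s (E : set 'rV[R]_d) (r : R) : (0 <= r)%R ->
  diameter E <= r%:E -> hausdorff_gauge s E <= (hausdorff_const s * r ^+ s)%:E.
Proof.
move=> r0 Er; rewrite /hausdorff_gauge; case: ifPn => _.
  by rewrite lee_fin mulr_ge0 ?exprn_ge0// hausdorff_const_ge0.
rewrite [leRHS]EFinM; apply: lee_wpmul2l; first by rewrite lee_fin hausdorff_const_ge0.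
elim: s => [|s IH]; first by rewrite expe0 expr0.
by rewrite expeS exprS EFinM lee_pmul// ?diameter_ge0// expe_ge0// diameter_ge0.
Qed.

Lemma hausdorff_content_finite s (delta r : R) (A : set 'rV[R]_d) (T : finType)
    (S : {set T}) (E : T -> set 'rV[R]_d) :
  (0 <= r)%R -> (r <= delta)%R ->
  (forall t, A t -> exists2 z, z \in S & E z t) ->
  (forall z, diameter (E z) <= r%:E) ->
  hausdorff_content s delta A <= (hausdorff_const s * r ^+ s * #|S|%:R)%:E.
Proof.
move=> r0 rd AE Er.
pose es := [seq E z | z <- enum S].
pose F k := nth set0 es k.
have sz : size es = #|S| by rewrite size_map -cardE.
have Fr k : diameter (F k) <= r%:E.
  rewrite /F; have [ks|ks] := ltnP k (size es); last first.
    by rewrite nth_default// diameter_le.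
  by have /mapP[z _ ->] := mem_nth set0 ks; exact: Er.
apply: (@le_trans _ _ (\sum_(k <oo) hausdorff_gauge s (F k))).
  apply: ereal_inf_lbound; exists F; split => //.
    move=> t /AE[z zS Et]; exists (index z (enum S)) => //.
    have zs : (index z (enum S) < size (enum S))%N by rewrite index_mem mem_enum.
    by rewrite /F /es (nth_map z)// nth_index// mem_enum.
  by move=> k; rewrite (le_trans (Fr k))// lee_fin.
rewrite (nneseries_split 0 #|S|); last by move=> k _; exact: hausdorff_gauge_ge0.
rewrite add0n [X in _ + X]eseries0 ?adde0; last first.
  by move=> k Sk _; rewrite /F nth_default ?sz// /hausdorff_gauge eqxx.
rewrite big_mkord (_ : (_ * #|S|%:R)%:E = \sum_(k < #|S|) (hausdorff_const s * r ^+ s)%:E).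
  by apply: lee_sum => k _; exact: hausdorff_gauge_le.
by rewrite sumEFin sumr_const card_ord mulr_natr.
Qed.

Lemma hausdorff_measure_le s (A : set 'rV[R]_d) (y : \bar R) :
  (forall delta : R, (0 < delta)%R -> hausdorff_content s delta A <= y) ->
  hausdorff_measure s A <= y.
Proof. by move=> H; apply: ge_ereal_sup => _ [delta /= d0 <-]; exact: H. Qed.

Lemma hausdorff_content_ge0 s delta (A : set 'rV[R]_d) :
  0 <= hausdorff_content s delta A.
Proof.
apply: le_ereal_inf_tmp => _ [E [_ _ ->]]; apply: nneseries_ge0 => k _ _.
exact: hausdorff_gauge_ge0.
Qed.

Lemma hausdorff_measure_ge0 s (A : set 'rV[R]_d) : 0 <= hausdorff_measure s A.
Proof.
apply: (le_trans (hausdorff_content_ge0 s 1%R A)).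
by apply: ereal_sup_ubound; exists 1%R => //=.
Qed.

End hausdorff_bound.

Section classification.
Context {R : realType} {d : nat} (a : R) (N : nat).
Hypotheses (a0 : 0 < a) (d0 : (0 < d)%N) (N0 : (0 < N)%N).
Let h := mesh a N.
Local Notation corner := (corner a).

Definition cell (z : cells d N) : set 'rV[R]_d :=
  [set t | forall i, corner z ord0 i <= t ord0 i <= corner z ord0 i + mesh a N].

Lemma cell_box z : cell z `<=` box (corner z) h.
Proof.
move=> t tz i; have /andP[t1 t2] := tz i.
by rewrite ger0_norm ?subr_ge0// lerBlDl.
Qed.

Lemma cell_diameter z : (diameter (cell z) <= (d%:R * h)%:E)%E.
Proof.
have h0 := mesh_gt0 a0 N0; rewrite -/h in h0.
have dh0 : 0 <= d%:R * h by rewrite mulr_ge0// ltW.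
apply: diameter_le => // x y zx zy.
rewrite /enorm -(ger0_norm dh0) -sqrtr_sqr ler_sqrt ?sqr_ge0//.
apply: (@le_trans _ _ (\sum_(i < d) h ^+ 2)).
  apply: ler_sum => i _; rewrite -[leLHS]real_normK ?num_real//.
  rewrite ler_pXn2r// ?nnegrE ?(ltW h0)//; rewrite !mxE.
  have := zx i; have := zy i; rewrite -/h ler_norml; lra.
rewrite sumr_const card_ord [leRHS]exprMn -[leLHS]mulr_natl ler_wpM2r ?sqr_ge0//.
by rewrite expr2 ler_peMl// ler1n.
Qed.

Lemma cell_cover t : cball d a t -> exists z, cell z t.
Proof.
rewrite cballE// => ta.
have ci i := cellidxP a0 N0 (coord_le a0 i ta).
exists [ffun i => Ordinal (ci i).1] => i.
by rewrite mxE ffunE /=; exact: (ci i).2.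
Qed.

(** The cells around which line_zero_or_near_critical can be applied. *)
Definition safe (z : cells d N) :=
  box (corner z) (d.+1%:R * mesh a N) `<=` oball a.

Lemma mesh_le : h <= 4 * a.
Proof.
rewrite /h /mesh ler_pdivrMr ?ltr0n// ler_peMr ?ler1n//.
by rewrite mulr_ge0// ltW.
Qed.

Lemma corner_le (z : cells d N) i : `|corner z ord0 i| <= 2 * a.
Proof.
rewrite mxE /grid; have h0 := mesh_gt0 a0 N0.
have : (z i)%:R * mesh a N <= N%:R * mesh a N.
  by rewrite ler_wpM2r ?(ltW h0)// ler_nat ltnW.
have -> : N%:R * mesh a N = 4 * a by rewrite /mesh mulrC divfK// pnatr_eq0 -lt0n.
have : 0 <= (z i)%:R * mesh a N by rewrite mulr_ge0// ltW.
by rewrite ler_norml; lra.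
Qed.

(** A box of half-width (d + 1) h around a corner has d coordinates, each moving by
    at most (d + 1) h, while the sum of two values of a coordinate is at most
    4 a (d + 2): the product bounds the variation of the squared norm. *)
Definition shell_width : R := 4 * a * (d * d.+1 * d.+2)%:R.

Lemma sqn_box (z : cells d N) y : box (corner z) (d.+1%:R * h) y ->
  `|sqn (corner z) - sqn y| <= shell_width * h.
Proof.
move=> yb; rewrite /sqn -sumrB (le_trans (ler_norm_sum _ _ _))//.
have h0 := mesh_gt0 a0 N0; rewrite -/h in h0; have h4 := mesh_le.
rewrite (_ : shell_width * h =
    \sum_(i < d) (d.+1%:R * h) * (4 * a * d.+2%:R)); last first.
  rewrite sumr_const card_ord -mulr_natl /shell_width !natrM; ring.
apply: ler_sum => i _; rewrite subr_sqr normrM ler_pM//.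
  by rewrite distrC; exact: yb.
have -> : corner z ord0 i + y ord0 i =
   (y ord0 i - corner z ord0 i) + corner z ord0 i *+ 2 by rewrite mulr2n; ring.
rewrite (le_trans (ler_normD _ _))//.
have := corner_le z i; rewrite normrMn -mulr_natr.
have : d.+1%:R * h <= d.+1%:R * (4 * a) by rewrite ler_wpM2l.
have := yb i; rewrite -[d.+2%:R]natr1; lra.
Qed.

Lemma unsafe_shell z t : ~ safe z -> cell z t -> cball d a t ->
  `|sqn (corner z) - a ^+ 2| <= shell_width * h.
Proof.
rewrite cballE// => /existsNP[y /not_implyP[yb]] /negP; rewrite -leNgt => ya.
move=> /cell_box tb /= ta.
have {}tb : box (corner z) (d.+1%:R * h) t.
  by apply: le_box tb; rewrite ler_peMl ?ler1n// ltW// mesh_gt0.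
by have := sqn_box yb; have := sqn_box tb; rewrite !ler_norml; lra.
Qed.

Section level_set.
Variable f : 'rV[R]_d -> R.

Definition hit_cells : {set cells d N} :=
  [set z | `[< exists t, [/\ cell z t, cball d a t & f t = 0] >]]%SET.

(** With Lam of order h ^ 2, these are the cells around which
    line_zero_or_near_critical may fail to produce a crossing. *)
Definition near_level_cells (Lam : R) : {set cells d N} :=
  [set z | `[< safe z >] && (`|f (corner z)| <= Lam)]%SET.

Definition crossed_cells (j : 'I_d) : {set cells d N} :=
  [set z | `[< safe z /\ exists s, `|s| <= d.+1%:R * mesh a N /\
                          f (corner z + s *: unit_vec j) = 0 >]]%SET.

Definition crossings (j : 'I_d) (z : cells d N) : {set 'I_N} :=
  [set i | setcoord z j i \in crossed_cells j]%SET.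

(** The ratio of shell_width to rho = a / (2 d), the lower bound used for the
    largest coordinate of a point of the shell. *)
Definition shell_const : nat := 8 * d ^ 2 * d.+1 * d.+2.

(** A cell meeting the level set is unsafe, hence in the shell, or nearly
    critical, or crossed in some direction.  Each of the three families is
    counted as a sum over directions and cells, so that the bound reads, after
    division by N ^ d, as a mean.  The summand 2 * shell_const + 3 is
    2 * (shell_const + 1) for the shell and 1 for the nearly critical cells. *)
Lemma card_hit_cells (g : 'I_d -> 'rV[R]_d -> R)
    (gg : 'I_d -> 'I_d -> 'rV[R]_d -> R) (M Lam : R) :
  (forall t i, oball a t -> is_derive t (unit_vec i) f (g i t)) ->
  (forall t i l, oball a t -> is_derive t (unit_vec l) (g i) (gg i l t)) ->
  (forall t i l, oball a t -> `|gg i l t| <= M) ->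
  2 * d%:R ^+ 2 * d.+1%:R * d.+2%:R * M * h ^+ 2 <= Lam ->
  (32 * (d * d.+1 * d.+2) <= N)%N ->
  (#|near_level_cells Lam| * N <= N ^ d)%N ->
  (N * #|hit_cells| <=
   \sum_(j < d) \sum_(z : cells d N) (2 * shell_const + 3 + #|crossings j z|))%N.
Proof.
move=> fD gD ggM ML dN near.
have h0 := mesh_gt0 a0 N0; rewrite -/h in h0.
pose shell := [set z in hit_cells | ~~ `[< safe z >]]%SET.
have sub : hit_cells \subset
    shell :|: (near_level_cells Lam :|: \bigcup_(j < d) crossed_cells j)%SET.
  apply/fintype.subsetP => z zH; rewrite !finset.in_setU.
  have [sz|nsz] := boolP `[< safe z >]; last by rewrite finset.in_set zH nsz.
  move: (sz) zH => /asboolP sz'; rewrite finset.in_set => /asboolP[t [zt ta ft]].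
  apply/orP; right.
  have [[j [s [sh fs]]]|crit] := line_zero_or_near_critical d0 h0
    (fun p i pb => fD p i (sz' p pb)) (fun p i l pb => gD p i l (sz' p pb))
    (fun p i l pb => ggM p i l (sz' p pb)) (cell_box zt) ft.
    apply/orP; right; apply/finset.bigcupP; exists j => //; rewrite finset.in_set.
    by apply/asboolP; split => //; exists s.
  by apply/orP; left; rewrite finset.in_set sz; exact: le_trans crit ML.
have H1 : (N * #|shell| <= \sum_(j < d) \sum_(z : cells d N) 2 * shell_const.+1)%N.
  apply: (@card_shell _ a a0 _ _ _ _ shell_width (a / (2 * d%:R))) => //.
  - by rewrite divr_gt0// mulr_gt0// ltr0n.
  - rewrite /shell_width /shell_const le_eqVlt; apply/orP; left; apply/eqP.
    by rewrite !natrM; field; rewrite pnatr_eq0 -lt0n.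
  - have Nr : 0 < N%:R :> R by rewrite ltr0n.
    have dr : 1 <= d%:R :> R by rewrite ler1n.
    have -> : d%:R * (a / (2 * d%:R)) ^+ 2 = a ^+ 2 / (4 * d%:R).
      by field; rewrite pnatr_eq0 -lt0n.
    have H4 : a ^+ 2 / (4 * d%:R) <= a ^+ 2 / 2.
      by rewrite ler_wpM2l ?sqr_ge0// lef_pV2 ?posrE; lra.
    have : shell_width * mesh a N <= a ^+ 2 / 2.
      rewrite /shell_width /mesh !mulrA ler_pdivrMr//.
      have : (32 * (d * d.+1 * d.+2))%:R * a ^+ 2 <= N%:R * a ^+ 2.
        by rewrite ler_wpM2r ?sqr_ge0// ler_nat.
      by rewrite natrM; lra.
    lra.
  - move=> z; rewrite !finset.in_set => /andP[/asboolP[t [zt ta _]] /asboolP sz].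
    exact: unsafe_shell zt ta.
have H2 : (N * \sum_(j < d) #|crossed_cells j| =
    \sum_(j < d) \sum_(z : cells d N) #|crossings j z|)%N.
  by rewrite big_distrr/=; apply: eq_bigr => j _; rewrite sum_setcoord.
have H3 : (N * #|near_level_cells Lam| <= \sum_(j < d) \sum_(z : cells d N) 1)%N.
  rewrite mulnC (leq_trans near)// (bigD1 (Ordinal d0))//=.
  by rewrite sum1_card card_ffun !card_ord leq_addr.
have -> : (\sum_(j < d) \sum_(z : cells d N) (2 * shell_const + 3 + #|crossings j z|) =
  \sum_(j < d) \sum_(z : cells d N) 2 * shell_const.+1 +
  (\sum_(j < d) \sum_(z : cells d N) 1 +
  \sum_(j < d) \sum_(z : cells d N) #|crossings j z|))%N.
  rewrite -!big_split/=; apply: eq_bigr => j _; rewrite -!big_split/=.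
  by apply: eq_bigr => z _; lia.
rewrite -H2 (leq_trans _ (leq_add H1 (leq_add H3 (leqnn _))))//.
rewrite -!mulnDr leq_mul2l; apply/orP; right.
rewrite (leq_trans (subset_leq_card sub))// (leq_trans (leq_card_setU _ _))//.
by rewrite leq_add2l (leq_trans (leq_card_setU _ _))// leq_add2l card_bigcup_le.
Qed.

End level_set.
End classification.

(** * Crossings of a line parallel to an axis *)

Section line.
Context {R : realType} {d N : nat} (a : R).
Hypothesis a0 : 0 < a.
Implicit Types (z : cells d N) (j : 'I_d).

Definition line_pt z j (s : R) : 'rV[R]_d :=
  (corner a z - grid a N (z j) *: unit_vec j) + s *: unit_vec j.

Lemma line_pt_coord z j s i :
  line_pt z j s ord0 i = if i == j then s else grid a N (z i).
Proof.
rewrite /line_pt /unit_vec !mxE eqxx /=; case: eqVneq => [->|_] /=.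
  by rewrite !mulr1 subrr add0r.
by rewrite !mulr0 subr0 addr0.
Qed.

Lemma corner_setcoord_line z j i s :
  corner a (setcoord z j i) + s *: unit_vec j = line_pt z j (grid a N i + s).
Proof.
apply/rowP => l; rewrite line_pt_coord /unit_vec !mxE eqxx ffunE /=.
by case: eqVneq; rewrite ?mulr1// mulr0 addr0.
Qed.

Lemma sqn_line_pt z j s :
  sqn (line_pt z j s) = s ^+ 2 + \sum_(l < d | l != j) grid a N (z l) ^+ 2.
Proof.
rewrite /sqn (bigD1 j)//= line_pt_coord eqxx; congr +%R.
by apply: eq_bigr => l lj; rewrite line_pt_coord (negPf lj).
Qed.

(** On a line parallel to an axis, the squared norm is a constant plus the square
    of the parameter. *)
Lemma line_oball_interval z j : is_interval [set s | oball a (line_pt z j s)].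
Proof.
move=> s t; rewrite /oball/= => sz tz y /andP[sy yt]; move: sz tz.
rewrite !sqn_line_pt; set c := \sum_(_ < _ | _) _.
have [y0|y0] := leP 0 y; nra.
Qed.

Definition block n r : set R :=
  [set s | grid a n r <= s <= grid a n r + mesh a n].

Definition slot n z j (r : 'I_n) : set 'rV[R]_d :=
  line_pt z j @` ([set s | oball a (line_pt z j s)] `&` block n r).

(** The point where the field is tested must not depend on the sample path, and
    must lie in the part of the block inside the ball, where the bound on the
    density and the smoothness hold; any choice will do. *)
Definition probe n z j (r : 'I_n) : 'rV[R]_d := xget 0 (slot z j r).

(** Each crossing has a zero within (d + 1) mesh of its position, so that one zero
    serves at most 2 (d + 1) + 1 crossings.  If the count is exceeded, one of the
    n blocks contains more than k distinct zeros, and zeros_small makes the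
    function small at the probe of this block.  The family H consists of the
    function and its successive derivatives. *)
Lemma card_crossings (H : nat -> 'rV[R]_d -> R) (k n : nat) (L : R) z j :
  (forall i t, (i < k)%N -> oball a t ->
    is_derive t (unit_vec j) (H i) (H i.+1 t)) ->
  (forall t, oball a t -> `|H k t| <= L) -> (0 < n)%N ->
  (forall r : 'I_n, slot z j r !=set0 ->
     mesh a n ^+ k * L < `|H 0 (probe z j r)|) ->
  (#|crossings a (H 0) j z| <= n * (k * (2 * d.+1).+1))%N.
Proof.
move=> HD HL n0 Hprobe; set A := crossings _ _ _ _.
have /choice[s Hs] (i : 'I_N) : exists s : R, i \in A ->
    [/\ `|s| <= d.+1%:R * mesh a N, H 0 (line_pt z j (grid a N i + s)) = 0 &
        oball a (line_pt z j (grid a N i + s))].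
  have [iA|/negP niA] := boolP (i \in A); last by exists 0 => iA; case: niA.
  move: iA; rewrite !finset.in_set => /asboolP[sf [s [sh fs]]].
  exists s => _; rewrite -corner_setcoord_line; split => //.
  by apply: sf; exact: box_line.
(* Parameter on the line of the zero attached to the crossing at position i. *)
pose pos (i : 'I_N) := grid a N i + s i.
have pos_le i : i \in A -> `|pos i| <= a.
  move=> /Hs[_ _ ob]; have := coord_le a0 j (ltW ob).
  by rewrite line_pt_coord eqxx.
pose Ar (r : 'I_n) := [set i in A | cellidx a n (pos i) == r :> nat]%SET.
have ArE i (r : 'I_n) : (i \in Ar r) = (i \in A) && (cellidx a n (pos i) == r :> nat).
  by rewrite finset.in_set.
have sub : A \subset (\bigcup_(r < n) Ar r)%SET.
  apply/fintype.subsetP => i iA; have [c1 _] := cellidxP a0 n0 (pos_le i iA).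
  by apply/finset.bigcupP; exists (Ordinal c1) => //; rewrite ArE iA /=.
apply: (leq_trans (subset_leq_card sub)).
apply: (leq_trans (card_bigcup_le _)).
rewrite -[X in (X * _)%N](card_ord n) -sum_nat_const; apply: leq_sum => r _.
have spread : {in Ar r &, forall i i' : 'I_N, pos i = pos i' -> (i <= i' + 2 * d.+1)%N}.
  move=> i i'; rewrite !ArE => /andP[iA _] /andP[iA' _].
  have [s1 _ _] := Hs i iA; have [s2 _ _] := Hs i' iA'.
  have N0 : (0 < N)%N by case: i {iA s1} => i; case: (N).
  have h0 := mesh_gt0 a0 N0.
  rewrite /pos /grid => e; rewrite -(ler_nat R) -(ler_pM2r h0).
  move: s1 s2; rewrite !ler_norml natrD mulrDl natrM; lra.
apply: (leq_trans (card_fibers spread)); rewrite leq_mul2r; apply/orP; right.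
set us := undup _; rewrite leqNgt; apply/negP => kus.
pose S := take k (sort <=%R us).
have sS : size S = k by rewrite size_take size_sort kus.
have uS : {subset S <= [seq pos i | i in Ar r]}.
  by move=> y /mem_take; rewrite mem_sort mem_undup.
have ltS : sorted <%R S.
  by apply: take_sorted; rewrite sort_lt_sorted undup_uniq.
pose I := [set s | oball a (line_pt z j s)] `&` block n r.
have IS : {in S, forall y, I y /\ H 0 (line_pt z j y) = 0}.
  move=> y /uS/mapP[i]; rewrite mem_enum ArE => /andP[iA /eqP ir] ->.
  have [_ f0 ob] := Hs i iA; split => //; split => //.
  by have [_] := cellidxP a0 n0 (pos_le i iA); rewrite ir.
have Ius y : y \in us -> I y.
  rewrite mem_undup => /mapP[i]; rewrite mem_enum ArE => /andP[iA /eqP ir] ->.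
  have [_ _ ob] := Hs i iA; split => //.
  by have [_] := cellidxP a0 n0 (pos_le i iA); rewrite ir.
have ne : slot z j r !=set0.
  have [y yus] : exists y, y \in us.
    by case: (us) (leq_ltn_trans (leq0n k) kus) => // y s' _; exists y; rewrite mem_head.
  by exists (line_pt z j y), y => //; exact: Ius.
have [x Ix xp] := xgetPex 0 ne; rewrite -/(probe z j r) in xp.
have := Hprobe r ne; rewrite -xp ltNge => /negP; apply.
have iI : is_interval I.
  move=> s1 s2 [c1 b1] [c2 b2] y /andP[y1 y2]; split.
    by apply: (line_oball_interval c1 c2); rewrite y1.
  by move: b1 b2; rewrite /block/=; lra.
apply: (@zeros_small _ I (fun i y => H i (line_pt z j y)) k (mesh a n) L S) => //.
- exact/ltW/mesh_gt0.
- by move=> y1 y2 [_ b1] [_ b2]; move: b1 b2; rewrite /block/= ler_norml; lra.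
- by move=> i y ik [by_ _]; apply: is_derive_line; exact: HD.
- by move=> y [by_ _]; exact: HL.
Qed.

End line.

(** * Integrals of dominated functions, small balls and large derivatives *)

Section lower_integral.
Context d (T : measurableType d) (R : realType) (mu : {measure set T -> \bar R}).
Local Open Scope ereal_scope.

(** The Hausdorff measure of a random level set and the supremum of a random
    derivative are not known to be measurable.  The integral of a non-negative
    function is by definition a supremum over simple functions below it, so
    monotonicity holds regardless. *)
Lemma ge0_le_integralT (f g : T -> \bar R) :
  (forall x, 0 <= f x) -> (forall x, f x <= g x) ->
  \int[mu]_x f x <= \int[mu]_x g x.
Proof.
move=> f0 fg; have g0 x : 0 <= g x by exact: le_trans (fg x).
rewrite !ge0_integralTE//; apply: ge_ereal_sup => _ [h /= hf <-].
by apply: ereal_sup_ubound; exists h => //= x; exact: le_trans (fg x).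
Qed.

Lemma ge0_le_integral_outside (N : set T) (f g : T -> \bar R) :
  measurable N -> mu N = 0 -> measurable_fun [set: T] g ->
  (forall x, 0 <= f x) -> (forall x, 0 <= g x) -> (forall x, ~ N x -> f x <= g x) ->
  \int[mu]_x f x <= \int[mu]_x g x.
Proof.
move=> mN N0 mg f0 g0 fg.
(* Infinite on the null set: a majorant of f everywhere, with the integral of g. *)
pose G x := if x \in N then +oo else g x.
have mG : measurable_fun setT G.
  apply: measurable_fun_ifT => //; apply: (@measurable_fun_bool _ _ _ _ true).
  rewrite setTI (_ : _ @^-1` _ = N)//.
  by apply/seteqP; split=> x /=; [move/set_mem|move/mem_set].
apply: (@le_trans _ _ (\int[mu]_x G x)).
  apply: ge0_le_integralT => // x; rewrite /G.
  by case: ifPn; [rewrite leey|rewrite notin_setE; exact: fg].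
rewrite (@ge0_negligible_integral _ _ _ mu setT N)//; last first.
  by move=> x _; rewrite /G; case: ifPn.
rewrite [leLHS](@eq_integral _ _ _ mu _ g); last first.
  by move=> x; rewrite inE => -[_ Nx]; rewrite /G memNset.
by apply: ge0_subset_integral => //; exact: measurableD.
Qed.

End lower_integral.

Section small_ball.
Context {R : realType} {disp : measure_display} {Omega : measurableType disp}.
Variable P : probability Omega R.

Lemma measurable_near (Y : {RV P >-> R}) (u r : R) :
  measurable [set w | `|Y w - u| <= r].
Proof.
rewrite (_ : [set _ | _] = Y @^-1` `[u - r, u + r]).
  by rewrite -[X in measurable X]setTI; exact: measurable_funPT.
by apply/seteqP; split=> w /=; rewrite in_itv/= ler_norml; lra.
Qed.

Lemma small_ball (Y : {RV P >-> R}) (f : R -> R) (C u r : R) :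
  is_density Y f -> (forall x, f x <= C) -> 0 <= r ->
  (P [set w | (`|Y w - u| <= r)%R] <= (2 * C * r)%:E)%E.
Proof.
move=> [mf f0 Yf] fC r0.
rewrite (_ : [set _ | _] = Y @^-1` `[u - r, u + r]); last first.
  by apply/seteqP; split=> w /=; rewrite in_itv/= ler_norml; lra.
pose I : set R := [set` `[u - r, u + r]].
have := Yf I (measurable_itv _); rewrite /distribution /pushforward => ->.
have C0 : 0 <= C by exact: le_trans (f0 0) (fC 0).
apply: (@le_trans _ _ (\int[lebesgue_measure]_(x in I) cst C%:E x)%E).
  apply: ge0_le_integral => //.
  - exact: measurable_itv.
  - by move=> x _; rewrite lee_fin.
  - by apply/measurable_EFinP; apply: measurable_funTS.
  - by move=> x _; rewrite lee_fin.
rewrite integral_cst ?/I//= lebesgue_measure_itv/= lte_fin.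
case: ifPn => _; last by rewrite mule0 lee_fin !mulr_ge0.
by rewrite -EFinB -EFinM lee_fin; lra.
Qed.

End small_ball.

Section derivative_event.
Context {R : realType} {disp : measure_display} {Omega : measurableType disp}.
Variable P : probability Omega R.
Context {d : nat} (X : 'rV[R]_d -> {RV P >-> R}) (a : R) (k : nat).
Hypothesis a0 : 0 < a.
Variable N0 : set Omega.
Hypotheses (mN0 : measurable N0)
  (smooth : forall w, ~ N0 w -> Ck k (cball d a) (fun t => X t w)).
Variable j : 'I_d.

Local Notation DX i w := (dderiv j i (fun t => X t w)).

(** A derivative is the limit of difference quotients along a fixed sequence of
    steps, chosen so short that the points of evaluation stay in the ball, where
    the induction hypothesis applies. *)
Lemma measurable_dderiv i t : (i <= k)%N -> oball a t ->
  measurable_fun (~` N0) (fun w => DX i w t).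
Proof.
elim: i t => [|i IH] t ik ot.
  by apply: measurable_funTS; exact: measurable_funPT.
have : \forall s \near (0 : R), oball a (s *: unit_vec j + t).
  have : open_nbhs t (oball a) by split=> //; exact: oball_open.
  move=> /open_nbhs_nbhs ob.
  have c : (s *: unit_vec j + t) @[s --> (0 : R)] --> t.
    rewrite -[X in _ --> X]add0r -[X in X + t](scale0r (unit_vec j)).
    by apply: cvgD; [apply: cvgZr_tmp|exact: cvg_cst].
  exact: c.
move=> /nbhs_ballP[e /= e0 He].
pose s n : R := e / 2 * harmonic n.
have s0 n : 0 < s n by rewrite mulr_gt0 ?divr_gt0 ?harmonic_gt0.
have so n : oball a (s n *: unit_vec j + t).
  apply: He; rewrite /ball/= sub0r normrN gtr0_norm//.
  rewrite (@le_lt_trans _ _ (e / 2))//; last lra.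
  by rewrite ler_piMr ?divr_ge0 ?(ltW e0)// invf_le1// ler1n.
apply: (@measurable_fun_cvg _ _ _ _
  (fun n w => (s n)^-1 * (DX i w (s n *: unit_vec j + t) - DX i w t))).
  move=> n; apply: measurable_funM => //; apply: measurable_funB; apply: IH => //; exact: ltnW.
move=> w Nw; have [HD _ _] := Ck_dderiv j (smooth Nw).
have [dv dE] := HD i t ik (oball_interior a0 ot).
suff : (s n)^-1 * (DX i w (s n *: unit_vec j + t) - DX i w t) @[n --> \oo] -->
    'D_(unit_vec j) (DX i w) t by rewrite dE.
have dl : h^-1 * (DX i w (h *: unit_vec j + t) - DX i w t) @[h --> (0 : R)^'] -->
    'D_(unit_vec j) (DX i w) t by exact: dv.
have sc : s n @[n --> \oo] --> 0.
  by rewrite -(mulr0 (e / 2)); apply: cvgMl_tmp; exact: cvg_harmonic.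
exact: ((cvgr_dnbhsP _ _ _).1 dl s (conj (fun n => lt0r_neq0 (s0 n)) sc)).
Qed.

(** The corners of all grids are dense in the ball, so that this countable union
    captures, by continuity, a large value of the derivative at any point; it is
    measurable where the corresponding supremum might not be. *)
Definition large_deriv (L : R) : set Omega :=
  \bigcup_n \bigcup_(z in [set z : cells d n.+1 | oball a (corner a z)])
    [set w | ~ N0 w /\ L < `|DX k w (corner a z)|].

Lemma measurable_large_deriv L : measurable (large_deriv L).
Proof.
apply: bigcup_measurable => n _; apply: fin_bigcup_measurable; first exact: finite_finset.
move=> z oz; have := measurable_dderiv (leqnn k) oz.
have mC : measurable (~` N0) by exact: measurableC.
move=> /(measurableT_comp (@normr_measurable R setT)) /(_ mC [set` `]L, +oo[] (measurable_itv _)).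
by congr measurable; apply/seteqP; split=> w /=; rewrite in_itv/= andbT.
Qed.

Lemma large_derivP L w : ~ N0 w -> ~ large_deriv L w ->
  forall t, oball a t -> `|DX k w t| <= L.
Proof.
move=> Nw nE t ot; rewrite leNgt; apply/negP => Lt; apply: nE.
have [_ ct _] := Ck_dderiv j (smooth Nw).
have near : \forall s \near t, oball a s /\ L < `|DX k w s|.
  near=> s; split; first by near: s; apply: open_nbhs_nbhs; split=> //; exact: oball_open.
  by near: s; move: L Lt; apply: cvgr_gt; apply: cvg_norm; apply: ct; exact: oball_interior.
move: near => /nbhs_ballP[e /= e0 He].
have ta i := coord_le a0 i (ltW ot).
have [n hn] : exists n, mesh a n.+1 < e.
  have e4 : 0 <= 4 * a / e by rewrite divr_ge0 ?(ltW e0)// mulr_ge0// ltW.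
  exists (Num.truncn (4 * a / e)); have /andP[_] := truncn_itv e4.
  by rewrite /mesh ltr_pdivrMr// ltr_pdivrMr// (mulrC e).
have ci i := cellidxP a0 (ltn0Sn n) (ta i).
pose z : cells d n.+1 := [ffun i => Ordinal (ci i).1].
have [|oz Lz] := He (corner a z).
  split=> // i l; rewrite /ball/= ord1 mxE ffunE /=.
  have [_ /andP[c1 c2]] := ci l.
  by rewrite ltr_norml; lra.
by exists n => //; exists z.
Unshelve. all: by end_near. Qed.

(** Markov's inequality.  The integrand need not be measurable, hence the
    comparison is between the indicator of the event, scaled by L ^ m, and
    the integrand itself. *)
Lemma large_deriv_prob (K : R) (m : nat) L : 0 < L ->
  (\int[P]_w (sup_norm (cball d a)
     (dirderiv (cball d a) k (unit_vec j) (fun t => X t w)) ^+ m) <= K%:E)%E ->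
  (P (large_deriv L) <= (K / L ^+ m)%:E)%E.
Proof.
move=> L0 hK.
rewrite -(@lee_pmul2l _ (L ^+ m)%:E)//; last by rewrite lte_fin exprn_gt0.
rewrite -EFinM mulrCA divff ?mulr1; last by rewrite gt_eqF// exprn_gt0.
apply: le_trans hK.
have -> : ((L ^+ m)%:E * P (large_deriv L) =
    \int[P]_w ((L ^+ m)%:E * (\1_(large_deriv L) w)%:E))%E.
  rewrite ge0_integralZl_EFin//; last by rewrite exprn_ge0// ltW.
  - by rewrite integral_indic ?setIT//; exact: measurable_large_deriv.
  - by apply/measurable_EFinP; exact: measurable_indic (measurable_large_deriv L).
have S0 w : (0 <= sup_norm (cball d a)
     (dirderiv (cball d a) k (unit_vec j) (fun t => X t w)))%E.
  apply: (@le_trans _ _ `|dirderiv (cball d a) k (unit_vec j) (fun t => X t w) 0|%:E).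
    by rewrite lee_fin.
  apply: ereal_sup_ubound; exists 0 => //; rewrite cballE//= /sqn big1 ?sqr_ge0//.
  by move=> i _; rewrite mxE expr0n.
apply: ge0_le_integralT => w.
  by rewrite mule_ge0// lee_fin ?exprn_ge0// ltW.
rewrite indicE; have [|_] := boolP (w \in large_deriv L); last by rewrite mule0 expe_ge0.
rewrite mule1 inE => -[n _ [z oz [Nw Lw]]].
have : (L%:E <= sup_norm (cball d a)
     (dirderiv (cball d a) k (unit_vec j) (fun t => X t w)))%E.
  apply: (@le_trans _ _ `|DX k w (corner a z)|%:E); first by rewrite lee_fin ltW.
  apply: ereal_sup_ubound; exists (corner a z); first exact: oball_cball.
  have [_ _ ->//] := Ck_dderiv j (smooth Nw).
  exact: oball_interior.
move: (sup_norm _ _) => S LS.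
elim: m => [|m IH]; first by rewrite expr0 expe0.
by rewrite exprS expeS EFinM lee_pmul// lee_fin ?exprn_ge0// ltW.
Qed.

End derivative_event.

(** * Means, series, lower limits and dyadic moment bounds *)

(** Jensen's inequality for the uniform distribution on a list, by adding one
    entry at a time. *)
Lemma powR_mean_le (R : realType) (T : Type) (s : seq T) (x : T -> R) (p : R) :
  1 <= p -> (forall i, 0 <= x i) -> (0 < size s)%N ->
  ((\sum_(i <- s) x i) / (size s)%:R) `^ p <= (\sum_(i <- s) x i `^ p) / (size s)%:R.
Proof.
move=> p1 x0; elim: s => // y s IH _; rewrite !big_cons /=.
have [/size0nil ->|s0] := posnP (size s).
  by rewrite !big_nil !addr0 !divr1.
set S := \sum_(i <- s) x i; set Sp := \sum_(i <- s) x i `^ p.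
set n := size s; have n0 : 0 < n%:R :> R by rewrite ltr0n.
have nS : n.+1%:R = n%:R + 1 :> R by rewrite -natr1.
have t0 : 0 <= (n.+1%:R)^-1 :> R by rewrite invr_ge0.
have t1 : (n.+1%:R)^-1 <= 1 :> R by rewrite invf_le1// ler1n.
have S0 : 0 <= S by rewrite /S sumr_ge0.
have := @convex_powR R p p1 (Itv01 t0 t1) (x y) (S / n%:R).
rewrite !inE/= !in_itv/= !andbT => /(_ (x0 y)) H.
have {H} := H (divr_ge0 S0 (ler0n _ _)).
rewrite convRE [X in X `^ _ <= _ -> _]convRE /=.
have w2 : 1 - n.+1%:R^-1 = n%:R / n.+1%:R :> R.
  by rewrite nS; field; rewrite -nS pnatr_eq0.
rewrite /unstable.onem w2.
have -> : n.+1%:R^-1 * x y + n%:R / n.+1%:R * (S / n%:R) = (x y + S) / n.+1%:R.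
  by field; rewrite addrC -nS !gt_eqF// ltr0n.
move=> /le_trans; apply.
have -> : (x y `^ p + Sp) / n.+1%:R = n.+1%:R^-1 * x y `^ p + n%:R / n.+1%:R * (Sp / n%:R).
  by field; rewrite addrC -nS !gt_eqF// ltr0n.
by rewrite lerD2l ler_wpM2l ?divr_ge0// IH.
Qed.

Section series.
Context {R : realType}.
Local Open Scope ereal_scope.

Lemma nneseries_le (u : nat -> \bar R) (B : \bar R) :
  (forall n, 0 <= u n) -> (forall n, \sum_(0 <= i < n) u i <= B) ->
  \sum_(i <oo) u i <= B.
Proof.
move=> u0 uB; apply: lime_le; first by apply: is_cvg_nneseries => n _ _.
exact: nearW.
Qed.

Lemma nneseries_geometric_le (u : nat -> \bar R) (c q : R) :
  (forall n, 0 <= u n) -> (0 <= c)%R -> (0 < q < 1)%R ->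
  (forall n, u n <= (c * q ^+ n)%:E) ->
  \sum_(i <oo) u i <= (c / (1 - q))%:E.
Proof.
move=> u0 c0 /andP[q0 q1] uq; apply: nneseries_le => // n.
apply: (@le_trans _ _ (\sum_(0 <= i < n) (c * q ^+ i)%:E)); first exact: lee_sum.
rewrite sumEFin lee_fin; apply: (@geometric_le_lim R n c q) => //.
by rewrite gtr0_norm.
Qed.

End series.

Section liminf.
Context {R : realType}.
Local Open Scope ereal_scope.

Lemma le_limn_einf (u : nat -> \bar R) (x : \bar R) (n0 : nat) :
  (forall n, (n0 <= n)%N -> x <= u n) -> x <= limn_einf u.
Proof.
move=> xu; rewrite limn_einf_lim; apply: lime_ge; first exact: is_cvg_einfs.
exists n0 => //= n nn; apply: le_ereal_inf_tmp => _ [i /= ni <-].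
by apply: xu; exact: leq_trans ni.
Qed.

Lemma limn_einf_le (u : nat -> \bar R) (x : \bar R) :
  (forall n, u n <= x) -> limn_einf u <= x.
Proof.
move=> ux; rewrite limn_einf_lim; apply: lime_le; first exact: is_cvg_einfs.
by apply: nearW => n; apply: (le_trans _ (ux n)); apply: ereal_inf_lbound; exists n => /=.
Qed.

Lemma measurable_limn_einf d (T : measurableType d) (f : nat -> T -> \bar R) :
  (forall n, measurable_fun [set: T] (f n)) ->
  measurable_fun [set: T] (fun x => limn_einf (f^~ x)).
Proof.
move=> mf; rewrite /limn_einf; apply: measurableT_comp => //.
by apply: measurable_fun_limn_esup => n; apply: measurableT_comp.
Qed.

End liminf.

Lemma exp2_ge (R : realType) (x : R) :
  exists n0 : nat, forall n, (n0 <= n)%N -> x <= 2 ^+ n.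
Proof.
exists (Num.truncn `|x|).+1 => n xn; rewrite (le_trans (ler_norm x))//.
have /andP[_ /ltW/le_trans] := truncn_itv (normr_ge0 x); apply.
by rewrite -natrX ler_nat (leq_trans xn)// ltnW// ltn_expl.
Qed.

Section dyadic.
Context {R : realType} {disp : measure_display} {Omega : measurableType disp}.
Variable P : probability Omega R.
Variables (B p : R) (G : nat -> set Omega).
Hypotheses (B0 : 0 < B) (p0 : 0 <= p) (mG : forall r, measurable (G r)).

(** A measurable substitute for the p-th power of a quantity y for which only
    tail events are controlled: G (r + 1) is an event outside of which
    y <= B 2 ^ r. *)
Definition dyadic_bound (w : Omega) : \bar R :=
  (\sum_(r <oo) (((B * 2 ^+ r) `^ p)%:E * (\1_(G r) w)%:E))%E.

Lemma dyadic_bound_term_ge0 r w :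
  (0 <= ((B * 2 ^+ r) `^ p)%:E * (\1_(G r) w)%:E)%E.
Proof. by rewrite mule_ge0// lee_fin powR_ge0. Qed.

Lemma dyadic_bound_ge0 w : (0 <= dyadic_bound w)%E.
Proof. by apply: nneseries_ge0 => r _ _; exact: dyadic_bound_term_ge0. Qed.

Lemma measurable_dyadic_term r :
  measurable_fun setT (fun w => ((B * 2 ^+ r) `^ p)%:E * (\1_(G r) w)%:E)%E.
Proof.
apply: emeasurable_funM; first exact: measurable_cst.
by apply/measurable_EFinP; exact: measurable_indic.
Qed.

Lemma measurable_dyadic_bound : measurable_fun setT dyadic_bound.
Proof.
apply: (@ge0_emeasurable_sum _ _ _ _ _ xpredT).
  by move=> r w _ _; exact: dyadic_bound_term_ge0.
by move=> r _; exact: measurable_dyadic_term.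
Qed.

(** The term that dominates is that of the least r with y <= B 2 ^ r: by
    minimality y > B 2 ^ (r - 1), so that w lies in G r. *)
Lemma le_dyadic_bound (y : R) w : 0 <= y -> G 0 w ->
  (forall r, ~ G r.+1 w -> y <= B * 2 ^+ r) -> ((y `^ p)%:E <= dyadic_bound w)%E.
Proof.
move=> y0 G0 yB.
have ex : exists r, y <= B * 2 ^+ r.
  exists (Num.truncn (y / B)); rewrite mulrC -ler_pdivrMr//.
  have /andP[_ /ltW/le_trans] := truncn_itv (divr_ge0 y0 (ltW B0)); apply.
  by rewrite -natrX ler_nat ltn_expl.
have Gr : G (ex_minn ex) w.
  case: ex_minnP => -[|r] // yr rmin; apply: contrapT => /yB /rmin.
  by rewrite ltnn.
case: ex_minnP Gr => r yr _ Gr.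
apply: (@le_trans _ _
  (\sum_(0 <= i < r.+1) (((B * 2 ^+ i) `^ p)%:E * (\1_(G i) w)%:E))%E); last first.
  by apply: nneseries_lim_ge => i _ _; exact: dyadic_bound_term_ge0.
rewrite big_nat_recr//= indicE mem_set// mule1.
rewrite (@le_trans _ _ ((B * 2 ^+ r) `^ p)%:E)//; last first.
  by rewrite leeDr// sume_ge0// => i _; exact: dyadic_bound_term_ge0.
rewrite lee_fin ge0_ler_powR// nnegrE//.
by rewrite mulr_ge0// ltW.
Qed.

Lemma dyadic_bound_integral (c theta : R) : 0 <= c -> 0 < theta ->
  2 `^ p * theta < 1 -> (forall r, (P (G r) <= (c * theta ^+ r)%:E)%E) ->
  (\int[P]_w dyadic_bound w <= (B `^ p * c / (1 - 2 `^ p * theta))%:E)%E.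
Proof.
move=> c0 t0 pt PG; rewrite integral_nneseries//; last 2 first.
- exact: measurable_dyadic_term.
- by move=> r w _; exact: dyadic_bound_term_ge0.
apply: nneseries_geometric_le => //.
- by move=> r; apply: integral_ge0 => w _; exact: dyadic_bound_term_ge0.
- by rewrite mulr_ge0// powR_ge0.
- by rewrite pt mulr_gt0// powR_gt0.
move=> r; rewrite ge0_integralZl_EFin ?powR_ge0//; last first.
  by apply/measurable_EFinP; exact: measurable_indic.
rewrite integral_indic// setIT.
apply: (@le_trans _ _ (((B * 2 ^+ r) `^ p)%:E * (c * theta ^+ r)%:E)%E).
  have b0 : (0 < ((B * 2 ^+ r) `^ p)%:E)%E.
    by rewrite lte_fin powR_gt0// mulr_gt0// exprn_gt0.
  by rewrite lee_pmul2l//; exact: PG.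
have -> : (B * 2 ^+ r) `^ p = B `^ p * (2 `^ p) ^+ r.
  rewrite powRM ?(ltW B0) ?exprn_ge0// -[2 ^+ r]powR_mulrn// -powRrM.
  by rewrite [r%:R * p]mulrC powRrM powR_mulrn ?powR_ge0.
by rewrite -EFinM lee_fin exprMn le_eqVlt; apply/orP; left; apply/eqP; ring.
Qed.

End dyadic.

(** * Moments of the measure of a level set *)

Section level.
Context {R : realType} {disp : measure_display} {Omega : measurableType disp}.
Variable P : probability Omega R.
Context {d : nat} (X : 'rV[R]_d -> {RV P >-> R}) (a u : R) (k m : nat).
Hypotheses (d0 : (0 < d)%N) (a0 : 0 < a) (k0 : (0 < k)%N).
Variable N0 : set Omega.
Hypotheses (mN0 : measurable N0) (PN0 : P N0 = 0%E)
  (smooth : forall w, ~ N0 w -> Ck k (cball d a) (fun t => X t w)).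
Variables (C K : R).
Hypotheses (C0 : 0 <= C) (K0 : 0 <= K).
Hypothesis small : forall t (r : R), cball d a t -> 0 <= r ->
  (P [set w | (`|X t w - u| <= r)%R] <= (2 * C * r)%:E)%E.
Hypothesis moment : forall j, (\int[P]_w (sup_norm (cball d a)
     (dirderiv (cball d a) k (unit_vec j) (fun t => X t w)) ^+ m) <= K%:E)%E.

Let f (w : Omega) (t : 'rV[R]_d) : R := X t w - u.

Lemma bigsetU_sub (I : finType) (F : I -> set Omega) i :
  F i `<=` \big[setU/set0]_i F i.
Proof. by rewrite (bigD1 i)//=; left. Qed.

Lemma bigsetU_le (I : Type) (s : seq I) (F : I -> set Omega) :
  (forall i, measurable (F i)) ->
  measurable (\big[setU/set0]_(i <- s) F i) /\
  (P (\big[setU/set0]_(i <- s) F i) <= \sum_(i <- s) P (F i))%E.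
Proof.
move=> mF; elim: s => [|i s [IHm IH]]; first by rewrite !big_nil measure0.
rewrite !big_cons; split; first exact: measurableU.
by rewrite (le_trans (measureU2 _ _ _))// leeD2l.
Qed.

(** The event that the field is close to u at the probe of the r-th block, as it
    must be when the block contains k zeros and the derivative is at most L. *)
Definition near_probe N (z : cells d N) j n (L : R) (r : 'I_n) : set Omega :=
  [set w | slot a z j r !=set0 /\ `|f w (probe a z j r)| <= mesh a n ^+ k * L].

Definition bad_line N (z : cells d N) j n L : set Omega :=
  large_deriv X a k N0 j L `|` \big[setU/set0]_(r < n) near_probe z j L r.

Lemma measurable_near_probe N (z : cells d N) j n L (r : 'I_n) :
  measurable (near_probe z j L r).
Proof.
have [ne|ne] := pselect (slot a z j r !=set0).
  have -> : near_probe z j L r = [set w | `|X (probe a z j r) w - u| <= mesh a n ^+ k * L].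
    by apply/seteqP; split=> w /= => [[]|].
  exact: measurable_near.
have -> : near_probe z j L r = set0 by apply/seteqP; split=> w //= => -[/ne].
exact: measurable0.
Qed.

Lemma measurable_bad_line N (z : cells d N) j n L : measurable (bad_line z j n L).
Proof.
apply: measurableU; first exact: (measurable_large_deriv a0 mN0 smooth).
exact: (bigsetU_le _ (measurable_near_probe z j L)).1.
Qed.

Lemma near_probe_prob N (z : cells d N) j n L (r : 'I_n) : 0 <= L ->
  (P (near_probe z j L r) <= (2 * C * (mesh a n ^+ k * L))%:E)%E.
Proof.
move=> L0; have n0 : (0 < n)%N by case: r => r; case: (n).
have r0 : 0 <= mesh a n ^+ k * L by rewrite mulr_ge0// exprn_ge0// ltW// mesh_gt0.
have [ne|ne] := pselect (slot a z j r !=set0); last first.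
  have -> : near_probe z j L r = set0 by apply/seteqP; split=> w //= => -[/ne].
  by rewrite measure0 lee_fin mulr_ge0// mulr_ge0.
have -> : near_probe z j L r = [set w | `|X (probe a z j r) w - u| <= mesh a n ^+ k * L].
  by apply/seteqP; split=> w /= => [[]|].
apply: small => //; rewrite /probe; have [s [sa _] <-] := xgetPex 0 ne.
exact: oball_cball.
Qed.

(** The derivative is one global event and is paid for once, instead of once for
    each block; this is why the resulting exponent has k - 1 in place of k. *)
Lemma bad_line_prob N (z : cells d N) j n L : 0 < L ->
  (P (bad_line z j n L) <= (K / L ^+ m + n%:R * (2 * C * (mesh a n ^+ k * L)))%:E)%E.
Proof.
move=> L0; rewrite (le_trans (measureU2 _ _ _))//.
- exact: (measurable_large_deriv a0 mN0 smooth).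
- exact: (bigsetU_le _ (measurable_near_probe z j L)).1.
rewrite EFinD leeD//; first exact: (large_deriv_prob a0 mN0 smooth L0 (moment j)).
rewrite (le_trans (bigsetU_le _ (measurable_near_probe z j L)).2)//.
rewrite (@le_trans _ _ (\sum_(r < n) (2 * C * (mesh a n ^+ k * L))%:E))//.
  by apply: lee_sum => r _; apply: near_probe_prob; exact: ltW.
by rewrite sumEFin sumr_const card_ord -[_ *+ n]mulr_natl.
Qed.

Lemma good_line N (z : cells d N) j n L w : (0 < n)%N ->
  ~ N0 w -> ~ bad_line z j n L w ->
  (#|crossings a (f w) j z| <= n * (k * (2 * d.+1).+1))%N.
Proof.
move=> n0 Nw nb.
have [HD _ _] := Ck_dderiv j (smooth Nw).
pose H i := if i is 0 then f w else dderiv j i (fun t => X t w).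
apply: (@card_crossings _ _ _ a a0 H k n L) => //.
- move=> [|i] t ik ot; last exact: (HD i.+1 t ik (oball_interior a0 ot)).
  have := HD 0%N t ik (oball_interior a0 ot).
  move=> D; have := is_deriveB D (is_derive_cst u t (unit_vec j)).
  by rewrite subr0.
- move=> t ot; rewrite /H -(prednK k0) prednK//.
  apply: (large_derivP a0 smooth Nw _ ot).
  by move=> lw; apply: nb; left.
move=> r ne; rewrite ltNge; apply/negP => le; apply: nb; right.
by apply: (@bigsetU_sub _ _ r); split.
Qed.

Section crowded.

(** The scale 4 ^ q leaves a factor 2 ^ q to dominate the random bound on second
    derivatives while the probabilities of crowded_prob remain summable. *)
Definition scale q := (4 ^ q)%N.

Definition crit_level q : R := 2 ^+ q * mesh a (scale q) ^+ 2.

Definition near_corner q (z : cells d (scale q)) : set Omega :=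
  [set w | safe a z /\ `|f w (corner a z)| <= crit_level q].

Definition crowded q : set Omega :=
  [set w | (scale q ^ d <
    #|near_level_cells a (scale q) (f w) (crit_level q)| * scale q)%N].

Lemma crit_level_ge0 q : 0 <= crit_level q.
Proof. by rewrite mulr_ge0 ?sqr_ge0// exprn_ge0. Qed.

Lemma measurable_near_corner q (z : cells d (scale q)) :
  measurable (near_corner z).
Proof.
have [sz|nsz] := pselect (safe a z).
  have -> : near_corner z = [set w | `|X (corner a z) w - u| <= crit_level q].
    by apply/seteqP; split=> w /= => [[]|].
  exact: measurable_near.
have -> : near_corner z = set0 by apply/seteqP; split=> w //= => -[/nsz].
exact: measurable0.
Qed.

Lemma near_corner_prob q (z : cells d (scale q)) :
  (P (near_corner z) <= (2 * C * crit_level q)%:E)%E.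
Proof.
have [sz|nsz] := pselect (safe a z); last first.
  have -> : near_corner z = set0 by apply/seteqP; split=> w //= => -[/nsz].
  by rewrite measure0 lee_fin mulr_ge0 ?crit_level_ge0// mulr_ge0.
have -> : near_corner z = [set w | `|X (corner a z) w - u| <= crit_level q].
  by apply/seteqP; split=> w /= => [[]|].
apply: small; last exact: crit_level_ge0.
apply: (oball_cball a0); apply: sz => i; rewrite subrr normr0.
by rewrite mulr_ge0// ltW// mesh_gt0// expn_gt0.
Qed.

Lemma card_near_level_cells q w :
  #|near_level_cells a (scale q) (f w) (crit_level q)|%:R =
  \sum_(z : cells d (scale q)) \1_(near_corner z) w :> R.
Proof.
rewrite -sum1_card natr_sum big_mkcond /=; apply: eq_bigr => z _.
rewrite finset.in_set indicE; case: ifPn => [/andP[/asboolP sz zn]|nz].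
  by rewrite mem_set.
rewrite memNset// => -[/asboolP sz zn].
by move: nz; rewrite sz zn.
Qed.

Lemma measurable_crowded q : measurable (crowded q).
Proof.
pose F w : R := \sum_(z : cells d (scale q)) \1_(near_corner z) w * (scale q)%:R.
have mF : measurable_fun setT F.
  apply: measurable_sum => z; apply: measurable_funM => //.
  by apply: measurable_indic; exact: measurable_near_corner.
have := mF measurableT [set` `](scale q ^ d)%:R, +oo[] (measurable_itv _).
rewrite setTI; congr measurable; apply/seteqP.
by split=> w /=; rewrite in_itv/= andbT /F -mulr_suml -card_near_level_cells -natrM ltr_nat.
Qed.

(** Markov's inequality for the number of cells whose corner is near the level.  There are N ^ d
    cells, each with probability O(2 ^ q h ^ 2) and h = 4 a / N; compared with
    the threshold N ^ (d - 1) this leaves O(2 ^ q / N) = O(2 ^ (- q)). *)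
Lemma crowded_prob q : (P (crowded q) <= (32 * C * a ^+ 2 * 2^-1 ^+ q)%:E)%E.
Proof.
have sc0 : (0 < scale q)%N by rewrite expn_gt0.
have Nr : 0 < (scale q)%:R :> R by rewrite ltr0n.
have Nd : 0 < (scale q)%:R ^+ d :> R by rewrite exprn_gt0.
have NdE : (0 < ((scale q)%:R ^+ d)%:E :> \bar R)%E by rewrite lte_fin.
rewrite -(@lee_pmul2l _ ((scale q)%:R ^+ d)%:E)//.
have -> : (((scale q)%:R ^+ d)%:E * P (crowded q) =
    \int[P]_w (((scale q)%:R ^+ d)%:E * (\1_(crowded q) w)%:E))%E.
  rewrite ge0_integralZl_EFin ?(ltW Nd)//; last first.
    by apply/measurable_EFinP; apply: measurable_indic; exact: measurable_crowded.
  by rewrite integral_indic ?setIT//; exact: measurable_crowded.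
apply: (@le_trans _ _ (\int[P]_w
    \sum_(z : cells d (scale q)) ((scale q)%:R%:E * (\1_(near_corner z) w)%:E))%E).
  apply: ge0_le_integralT => w; first by rewrite mule_ge0// lee_fin ltW.
  have -> : (\sum_(z : cells d (scale q)) ((scale q)%:R%:E : \bar R) * (\1_(near_corner z) w)%:E =
      ((scale q)%:R * #|near_level_cells a (scale q) (f w) (crit_level q)|%:R)%:E)%E.
    by rewrite card_near_level_cells mulr_sumr -sumEFin.
  rewrite indicE; have [|_] := boolP (w \in crowded q); last first.
    by rewrite mule0 lee_fin mulr_ge0.
  by rewrite inE /crowded/= mule1 lee_fin -natrX -natrM ler_nat mulnC => /ltnW.
have mI z : measurable_fun setT (fun w => ((scale q)%:R%:E * (\1_(near_corner z) w)%:E)%E).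
  apply: emeasurable_funM; first exact: measurable_cst.
  by apply/measurable_EFinP; apply: measurable_indic; exact: measurable_near_corner.
rewrite ge0_integral_sum//.
apply: (@le_trans _ _ (\sum_(z : cells d (scale q)) ((scale q)%:R * (2 * C * crit_level q))%:E)%E).
  apply: lee_sum => z _; rewrite ge0_integralZl_EFin//; last first.
    by apply/measurable_EFinP; apply: measurable_indic; exact: measurable_near_corner.
  rewrite integral_indic ?setIT//; last exact: measurable_near_corner.
  by rewrite EFinM lee_pmul2l ?lte_fin//; exact: near_corner_prob.
rewrite sumEFin -EFinM lee_fin sumr_const card_ffun !card_ord -[_ *+ _]mulr_natl natrX.
rewrite ler_pM2l// /crit_level /mesh .
have NE : (scale q)%:R = 2 ^+ q * 2 ^+ q :> R.
  by rewrite /scale natrX -exprMn -natrM.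
rewrite exprVn NE le_eqVlt; apply/orP; left; apply/eqP; field.
by rewrite expf_neq0.
Qed.

Lemma crowded_negligible : P (lim_sup_set crowded) = 0%E.
Proof.
apply: lim_sup_set_cvg0; first exact: measurable_crowded.
apply: (@le_lt_trans _ _ (32 * C * a ^+ 2 / (1 - 2^-1))%:E%E); last exact: ltry.
apply: nneseries_geometric_le => //.
- by rewrite mulr_ge0 ?sqr_ge0// mulr_ge0.
- by rewrite invr_gt0// invf_lt1// ltr0n ltr1n.
- exact: crowded_prob.
Qed.

End crowded.

Section line_moment.
Variable p : R.
Hypotheses (p1 : 1 <= p) (pk : p < m%:R / (m%:R + 1) * (k%:R - 1)).

Definition crossing_count N (z : cells d N) j w : R :=
  (2 * @shell_const d + 3 + #|crossings a (f w) j z|)%:R.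

(** The threshold for the derivative when a line is cut into 2 ^ r blocks is
    growth ^ r.  It balances the two terms of bad_line_prob:
    growth ^ (- m r) and 2 ^ (- (k - 1) r) growth ^ r are equal precisely because
    growth ^ (m + 1) = 2 ^ (k - 1). *)
Let growth : R := 2 `^ ((k%:R - 1) / (m%:R + 1)).

Let growth_gt0 : 0 < growth. Proof. exact: powR_gt0. Qed.

Lemma growthE : growth ^+ m.+1 = 2 ^+ k.-1.
Proof.
have kE : k%:R - 1 = k.-1%:R :> R by rewrite -[in LHS](prednK k0) -natr1 addrK.
have m0 : m%:R + 1 != 0 :> R by rewrite gt_eqF// ltr_wpDl.
rewrite -[LHS]powR_mulrn ?(ltW growth_gt0)// /growth -powRrM -[m.+1%:R]natr1.
by rewrite divfK// kE powR_mulrn.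
Qed.

(** This is where the range of p is used: growth ^ m = 2 ^ (m (k - 1) / (m + 1)),
    hence the geometric series of ratio 2 ^ p growth ^ (- m) converges. *)
Lemma pow2_lt_growth : 2 `^ p < growth ^+ m.
Proof.
rewrite -[ltRHS]powR_mulrn ?(ltW growth_gt0)// /growth -powRrM.
rewrite /powR ifN// ifN// ltr_expR ltr_pM2r; last by rewrite ln_gt0// ltr1n.
by rewrite (lt_le_trans pk)// le_eqVlt; apply/orP; left; apply/eqP; ring.
Qed.

Definition bad_event N (z : cells d N) j r : set Omega :=
  if r is r'.+1 then bad_line z j (2 ^ r') (growth ^+ r') else setT.

Definition line_const : R := (2 * @shell_const d + 3 + k * (2 * d.+1).+1)%:R.

(** The factor growth ^ m compensates the shift by one in bad_event, the term 1
    accounts for the sure event of index 0. *)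
Definition event_const : R := 1 + (K + 2 * C * (4 * a) ^+ k) * growth ^+ m.

Lemma measurable_bad_event N (z : cells d N) j r : measurable (bad_event z j r).
Proof. by case: r => [|r]; [exact: measurableT|exact: measurable_bad_line]. Qed.

Lemma event_const_ge0 : 0 <= event_const.
Proof.
rewrite addr_ge0// mulr_ge0 ?exprn_ge0 ?(ltW growth_gt0)// addr_ge0//.
by rewrite mulr_ge0 ?exprn_ge0 ?mulr_ge0// ltW.
Qed.

Lemma bad_event_prob N (z : cells d N) j r :
  (P (bad_event z j r) <= (event_const * (growth ^- m) ^+ r)%:E)%E.
Proof.
have g0 := growth_gt0.
have K1 : 0 <= K + 2 * C * (4 * a) ^+ k.
  by rewrite addr_ge0// mulr_ge0 ?exprn_ge0 ?mulr_ge0// ltW.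
have gm : 0 < growth ^+ m by rewrite exprn_gt0.
case: r => [|r].
  rewrite /= expr0 mulr1 probability_setT lee_fin /event_const lerDl mulr_ge0//.
  exact: ltW.
have n0 : (0 < 2 ^ r)%N by rewrite expn_gt0.
have gr : 0 < growth ^+ r by rewrite exprn_gt0.
rewrite (le_trans (bad_line_prob z j _ gr))// lee_fin.
set y : R := (2 ^ r)%:R; set g := growth ^+ r.
have y0 : 0 < y by rewrite ltr0n.
have gE : g ^+ m * g = y ^+ k.-1.
  rewrite -exprSr /g -exprM mulnC exprM growthE -exprM mulnC exprM.
  by rewrite /y natrX.
have -> : K / g ^+ m + y * (2 * C * (mesh a (2 ^ r) ^+ k * g)) =
    (K + 2 * C * (4 * a) ^+ k) / g ^+ m.
  rewrite /mesh -/y expr_div_n -[in y ^+ k](prednK k0) exprS -gE.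
  by field; rewrite !gt_eqF// exprn_gt0.
have -> : event_const * (growth ^- m) ^+ r.+1 =
    growth ^- m / g ^+ m + (K + 2 * C * (4 * a) ^+ k) / g ^+ m.
  rewrite /event_const /g exprS exprVn -!exprM mulnC.
  by field; rewrite !gt_eqF// exprn_gt0.
by rewrite lerDr divr_ge0 ?invr_ge0 ?exprn_ge0// ?ltW.
Qed.

Definition line_bound N (z : cells d N) j : Omega -> \bar R :=
  dyadic_bound line_const p (bad_event z j).

Definition moment_const : R :=
  line_const `^ p * event_const / (1 - 2 `^ p * growth ^- m).

Lemma line_const_gt0 : 0 < line_const.
Proof. by rewrite ltr0n addnC addnA addn_gt0 orbT. Qed.

Lemma line_bound_integral N (z : cells d N) j :
  (\int[P]_w line_bound z j w <= moment_const%:E)%E.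
Proof.
have gm : 0 < growth ^+ m by rewrite exprn_gt0 ?growth_gt0.
apply: dyadic_bound_integral => //.
- exact: line_const_gt0.
- exact: measurable_bad_event.
- exact: event_const_ge0.
- by rewrite invr_gt0.
- by rewrite ltr_pdivrMr// mul1r pow2_lt_growth.
- exact: bad_event_prob.
Qed.

Lemma crossing_count_le N (z : cells d N) j w : ~ N0 w ->
  ((crossing_count z j w `^ p)%:E <= line_bound z j w)%E.
Proof.
move=> Nw; apply: le_dyadic_bound => //.
- exact: line_const_gt0.
- exact: le_trans p1.
move=> r /(good_line (expn_gt0 2 r) Nw) c.
rewrite /crossing_count /line_const -natrX -natrM ler_nat mulnDl leq_add//.
  by rewrite leq_pmulr// expn_gt0.
by rewrite [leqRHS]mulnC.
Qed.

Section level_set.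
Hypothesis k2 : (2 <= k)%N.

Definition level_set (w : Omega) : set 'rV[R]_d :=
  [set t | cball d a t /\ X t w = u].

(** N ^ (1 - d) times a number of cells is turned into a mean over the d N ^ d
    pairs of a direction and a cell, which explains the last factor d. *)
Definition hausdorff_scale : R := hausdorff_const d.-1 * (4 * a * d%:R) ^+ d.-1 * d%:R.

(** Jensen's inequality moves the p-th power inside the mean over lines; each
    term is then replaced by its measurable bound. *)
Definition dominating q (w : Omega) : \bar R :=
  ((hausdorff_scale `^ p / (d * scale q ^ d)%:R)%:E *
   \sum_(jz : 'I_d * cells d (scale q)) line_bound jz.2 jz.1 w)%E.

Lemma hausdorff_scale_ge0 : 0 <= hausdorff_scale.
Proof.
have a0' := ltW a0; rewrite /hausdorff_scale mulr_ge0// mulr_ge0 ?hausdorff_const_ge0//.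
by rewrite exprn_ge0// !mulr_ge0.
Qed.

Lemma dominating_coef_ge0 q : 0 <= hausdorff_scale `^ p / (d * scale q ^ d)%:R.
Proof. by rewrite divr_ge0// powR_ge0. Qed.

Lemma measurable_dominating q : measurable_fun setT (dominating q).
Proof.
apply: emeasurable_funM; first exact: measurable_cst.
apply: emeasurable_sum => jz.
exact/measurable_dyadic_bound/measurable_bad_event.
Qed.

Lemma dominating_ge0 q w : (0 <= dominating q w)%E.
Proof.
rewrite mule_ge0 ?lee_fin ?dominating_coef_ge0//; apply: sume_ge0 => jz _.
exact: dyadic_bound_ge0.
Qed.

Lemma card_index q : #|{: 'I_d * cells d (scale q)}| = (d * scale q ^ d)%N.
Proof. by rewrite card_prod card_ffun !card_ord. Qed.

Lemma dominating_integral q :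
  (\int[P]_w dominating q w <= (hausdorff_scale `^ p * moment_const)%:E)%E.
Proof.
have mL (jz : 'I_d * cells d (scale q)) : measurable_fun setT (line_bound jz.2 jz.1).
  exact/measurable_dyadic_bound/measurable_bad_event.
have c0 := dominating_coef_ge0 q.
rewrite ge0_integralZl_EFin//; last 2 first.
- by move=> w _; apply: sume_ge0 => jz _; exact: dyadic_bound_ge0.
- exact: emeasurable_sum.
rewrite ge0_integral_sum//; last by move=> jz w _; exact: dyadic_bound_ge0.
apply: (@le_trans _ _ ((hausdorff_scale `^ p / (d * scale q ^ d)%:R)%:E *
   \sum_(jz : 'I_d * cells d (scale q)) moment_const%:E)%E).
  by apply: lee_wpmul2l => //; apply: lee_sum => jz _; exact: line_bound_integral.
rewrite sumEFin -EFinM lee_fin sumr_const card_index -[moment_const *+ _]mulr_natl mulrA divfK//.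
by rewrite pnatr_eq0 muln_eq0 negb_or -!lt0n d0 expn_gt0 expn_gt0.
Qed.

Lemma hausdorff_content_le q (delta : R) w (g : 'I_d -> 'rV[R]_d -> R)
    (gg : 'I_d -> 'I_d -> 'rV[R]_d -> R) (M : R) : ~ N0 w ->
  (forall t i, oball a t -> is_derive t (unit_vec i) (fun t => X t w) (g i t)) ->
  (forall t i l, oball a t -> is_derive t (unit_vec l) (g i) (gg i l t)) ->
  (forall t i l, oball a t -> `|gg i l t| <= M) ->
  2 * d%:R ^+ 2 * d.+1%:R * d.+2%:R * M <= 2 ^+ q ->
  (32 * (d * d.+1 * d.+2) <= scale q)%N ->
  d%:R * mesh a (scale q) <= delta ->
  ~ crowded q w ->
  (hausdorff_content d.-1 delta (level_set w) `^ p <= dominating q w)%E.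
Proof.
move=> Nw gD ggD ggM Mq dq hdelta /negP; rewrite -leqNgt => ncr.
have sc0 : (0 < scale q)%N by rewrite expn_gt0.
have sr : 0 < (scale q)%:R :> R by rewrite ltr0n.
have h0 := mesh_gt0 a0 sc0.
have dr : 0 < d%:R :> R by rewrite ltr0n.
have fD t i : oball a t -> is_derive t (unit_vec i) (f w) (g i t).
  move=> /gD - /(_ i) D; have := is_deriveB D (is_derive_cst u t (unit_vec i)).
  by rewrite subr0.
have ML : 2 * d%:R ^+ 2 * d.+1%:R * d.+2%:R * M * mesh a (scale q) ^+ 2 <= crit_level q.
  by rewrite ler_wpM2r ?sqr_ge0.
have hits := card_hit_cells a0 d0 sc0 fD ggD ggM ML dq ncr.
set T := ('I_d * cells d (scale q))%type.
pose S : R := \sum_(jz : T) crossing_count jz.2 jz.1 w.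
have cc0 (jz : T) : 0 <= crossing_count jz.2 jz.1 w by rewrite ler0n.
have S0 : 0 <= S by apply: sumr_ge0.
have hitS : (scale q)%:R * #|hit_cells a (scale q) (f w)|%:R <= S.
  rewrite -natrM (le_trans (y := (\sum_(j < d) \sum_(z : cells d (scale q))
     (2 * @shell_const d + 3 + #|crossings a (f w) j z|))%:R))// ?ler_nat//.
  rewrite pair_bigA natr_sum.
  by rewrite /S /crossing_count.
have content : (hausdorff_content d.-1 delta (level_set w) <=
    (hausdorff_scale * (S / (d * scale q ^ d)%:R))%:E)%E.
  have dh0 : 0 <= d%:R * mesh a (scale q) by rewrite mulr_ge0// ltW.
  apply: (le_trans (hausdorff_content_finite d.-1 dh0 hdelta
    (S := hit_cells a (scale q) (f w)) _ (cell_diameter a0 d0 sc0))).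
    move=> t [ta Xt]; have [z zt] := cell_cover a0 sc0 ta; exists z => //.
    rewrite finset.in_set; apply/asboolP; exists t; split => //.
    by rewrite /f Xt subrr.
  rewrite lee_fin /hausdorff_scale /mesh.
  have -> : hausdorff_const d.-1 * (4 * a * d%:R) ^+ d.-1 * d%:R * (S / (d * scale q ^ d)%:R)
     = hausdorff_const d.-1 * (d%:R * (4 * a / (scale q)%:R)) ^+ d.-1 * (S / (scale q)%:R).
    rewrite natrM natrX -[in LHS](prednK d0) exprS prednK//.
    rewrite !exprMn exprVn; field.
    by rewrite expf_neq0 ?gt_eqF.
  rewrite ler_wpM2l//; last by rewrite ler_pdivlMr// mulrC.
  by rewrite mulr_ge0 ?hausdorff_const_ge0// exprn_ge0.
have TE : size (enum {: T}) = (d * scale q ^ d)%N by rewrite -cardT card_index.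
have Tpos : (0 < d * scale q ^ d)%N by rewrite muln_gt0 d0 expn_gt0 sc0.
have mean : (S / (d * scale q ^ d)%:R) `^ p <=
    (\sum_(jz : T) crossing_count jz.2 jz.1 w `^ p) / (d * scale q ^ d)%:R.
  have := @powR_mean_le R T (enum {: T}) (fun jz => crossing_count jz.2 jz.1 w) p p1 cc0.
  by rewrite TE !big_enum; apply.
have p0 : 0 <= p by exact: le_trans p1.
apply: (@le_trans _ _ ((hausdorff_scale * (S / (d * scale q ^ d)%:R))%:E `^ p)%E).
  apply: gt0_ler_poweR => //; rewrite in_itv/= ?leey ?andbT.
    exact: hausdorff_content_ge0.
  by rewrite lee_fin mulr_ge0 ?hausdorff_scale_ge0// divr_ge0.
rewrite poweR_EFin powRM ?hausdorff_scale_ge0 ?divr_ge0//.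
apply: (@le_trans _ _ (hausdorff_scale `^ p *
  ((\sum_(jz : T) crossing_count jz.2 jz.1 w `^ p) / (d * scale q ^ d)%:R))%:E).
  by rewrite lee_fin ler_wpM2l// powR_ge0.
rewrite mulrCA mulrA mulrC mulrA [X in X%:E](_ : _ = hausdorff_scale `^ p / (d * scale q ^ d)%:R *
  \sum_(jz : T) crossing_count jz.2 jz.1 w `^ p); last by ring.
rewrite EFinM -sumEFin; apply: lee_wpmul2l; first by rewrite lee_fin dominating_coef_ge0.
by apply: lee_sum => jz _; exact: crossing_count_le.
Qed.

(** Almost surely the levels q at which the nearly critical cells are too many, or
    2 ^ q does not yet exceed the bound on the second derivatives, are finite in
    number.  For every delta the content at scale delta is thus bounded along the
    same sequence, and the bound passes to the supremum over delta. *)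
Lemma hausdorff_measure_level_le w : ~ N0 w -> ~ lim_sup_set crowded w ->
  (hausdorff_measure d.-1 (level_set w) `^ p <= limn_einf (dominating^~ w))%E.
Proof.
move=> Nw /existsNP[n1 /not_implyP[_ ncr]].
have [g [gg [M [gD ggD ggM]]]] := Ck_second_partials (cball_compact a0) k2 (smooth Nw).
have p0 : 0 < p by exact: lt_le_trans p1.
have key (delta : R) : 0 < delta ->
    (hausdorff_content d.-1 delta (level_set w) `^ p <= limn_einf (dominating^~ w))%E.
  move=> dl0.
  have [n2 H2] := exp2_ge (2 * d%:R ^+ 2 * d.+1%:R * d.+2%:R * M).
  have [n3 H3] := exp2_ge ((32 * (d * d.+1 * d.+2))%N%:R : R).
  have [n4 H4] := exp2_ge (d%:R * (4 * a) / delta).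
  apply: (@le_limn_einf _ _ _ (maxn (maxn n1 n2) (maxn n3 n4))) => q.
  rewrite !geq_max => /andP[/andP[q1 q2] /andP[q3 q4]].
  have scE : (2 ^+ q <= (scale q)%:R :> R) 
    by rewrite -natrX ler_nat /scale (expnMn 2 2) leq_pmulr// expn_gt0.
  apply: (hausdorff_content_le Nw (g := g) (gg := gg) (M := M)).
  - by move=> t i ot; apply: gD; exact: oball_interior.
  - by move=> t i l ot; apply: ggD; exact: oball_interior.
  - by move=> t i l ot; apply: ggM; exact: oball_cball.
  - exact: H2.
  - by rewrite -(ler_nat R) (le_trans (H3 q q3)).
  - have := le_trans (H4 q q4) scE; rewrite ler_pdivrMr// => H.
    by rewrite /mesh mulrA ler_pdivrMr ?ltr0n ?expn_gt0// [leRHS]mulrC.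
  - by move=> cr; apply: ncr; exists q.
set y := limn_einf _ in key *.
have y0 : (0 <= y)%E by rewrite (le_trans _ (key 1 ltr01))// poweR_ge0.
have Hy : (hausdorff_measure d.-1 (level_set w) <= y `^ p^-1)%E.
  apply: hausdorff_measure_le => delta dl0.
  have c0 := hausdorff_content_ge0 d.-1 delta (level_set w).
  rewrite -[leLHS]poweRe1// -(mulfV (lt0r_neq0 p0)) poweRrM.
  apply: gt0_ler_poweR => //; rewrite ?invr_ge0 ?(ltW p0)// ?in_itv/= ?leey ?andbT ?poweR_ge0//.
  exact: key.
have h0 := hausdorff_measure_ge0 d.-1 (level_set w).
rewrite -[leRHS]poweRe1// -(mulVf (lt0r_neq0 p0)) poweRrM.
by apply: gt0_ler_poweR => //; rewrite ?(ltW p0)// ?in_itv/= ?leey ?andbT ?poweR_ge0.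
Qed.

Lemma level_moment_finite :
  (\int[P]_w (hausdorff_measure d.-1 (level_set w) `^ p) < +oo)%E.
Proof.
pose N := N0 `|` lim_sup_set crowded.
have mlim : measurable (lim_sup_set crowded).
  apply: bigcapT_measurable => n; apply: bigcup_measurable => q _.
  exact: measurable_crowded.
have PN : P N = 0%E.
  by rewrite measureU0 //; exact: crowded_negligible.
apply: (@le_lt_trans _ _ (\int[P]_w limn_einf (dominating^~ w))%E).
  apply: (ge0_le_integral_outside (N := N)) => //.
  - exact: measurableU.
  - by apply: measurable_limn_einf; exact: measurable_dominating.
  - by move=> w; exact: poweR_ge0.
  - by move=> w; apply: (@le_limn_einf _ _ _ 0%N) => q _; exact: dominating_ge0.
  - by move=> w /not_orP[Nw lw]; exact: hausdorff_measure_level_le.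
apply: (@le_lt_trans _ _ (hausdorff_scale `^ p * moment_const)%:E%E); last exact: ltry.
apply: le_trans (fatou P measurableT measurable_dominating _) _.
  by move=> q w _; exact: dominating_ge0.
by apply: limn_einf_le => q; exact: dominating_integral.
Qed.

End level_set.

End line_moment.


End level.

Lemma usphere_unit_vec (R : realType) (d : nat) (j : 'I_d) :
  usphere (unit_vec j : 'rV[R]_d).
Proof.
rewrite /usphere /enorm/= (bigD1 j)//= big1 => [|i ij].
  by rewrite /unit_vec mxE !eqxx expr1n addr0 sqrtr1.
by rewrite /unit_vec mxE (negPf ij) andbF expr0n.
Qed.

Theorem corollary6p1 (R : realType) (disp : measure_display)
    (Omega : measurableType disp) (P : probability Omega R)
    (d : nat) (hd : (1 < d)%N)
    (beta : nat -> {RV P >-> R})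
    (hbeta_indep : independent_seq beta)
    (hbeta_id : identically_distributed beta)
    (hbeta_int : forall i, P.-integrable setT (EFin \o beta i))
    (lambda : R) (hlambda : 0 < lambda)
    (tau : nat -> {RV P >-> 'rV[R]_d})
    (htau : poisson_field lambda tau)
    (hindep : independent_of beta tau)
    (g : 'rV[R]_d -> R)
    (hg : (lebesgue_rV d).-integrable setT (EFin \o g))
    (X : 'rV[R]_d -> {RV P >-> R})
    (hX : shot_noise beta tau g X)
    (a : R) (ha : 0 < a) (u : R)
    (k : nat) (hk : (1 <= k)%N) (m : nat) (hm : (1 <= m)%N)
    (hpaths : {ae P, forall w, Ck k (cball d a) (fun t => X t w)})
    (hmoment : (ereal_sup
       [set \int[P]_w
              (sup_norm (cball d a)
                 (dirderiv (cball d a) k v (fun t => X t w)) ^+ m)%E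
        | v in @usphere R d] < +oo)%E)
    (hdensity : exists2 C : R, 0 < C &
       forall t, cball d a t ->
         exists2 f : R -> R, is_density (X t) f & forall x, f x <= C)
    (p : R) (hp : 1 <= p) (hpk : p < m%:R / (m%:R + 1) * (k%:R - 1)) :
  (\int[P]_w
     (hausdorff_measure d.-1 [set t | cball d a t /\ X t w = u] `^ p) < +oo)%E.
Proof.
have d0 : (0 < d)%N by exact: ltnW.
have k2 : (2 <= k)%N.
  rewrite ltnNge; apply/negP => k1.
  suff : m%:R / (m%:R + 1) * (k%:R - 1) <= 0 :> R.
    by move=> /(lt_le_trans hpk) /(le_lt_trans hp); rewrite ltr10.
  by rewrite mulr_ge0_le0// ?divr_ge0 ?addr_ge0// subr_le0 -[1]/(1%:R) ler_nat.
have [N0 [mN0 PN0 smoothN0]] := hpaths.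
have smooth w : ~ N0 w -> Ck k (cball d a) (fun t => X t w).
  by move=> Nw; apply: contrapT => nCk; apply: Nw; exact: smoothN0.
have [C C0 dens] := hdensity.
have small t (r : R) : cball d a t -> 0 <= r ->
    (P [set w | (`|X t w - u| <= r)%R] <= (2 * C * r)%:E)%E.
  by move=> /dens[f fd fC] r0; exact: small_ball fd fC r0.
set S := ereal_sup _ in hmoment.
pose K := Num.max 0 (fine S).
have SK : (S <= K%:E)%E.
  move: hmoment; rewrite /K; case: (S) => [r _|//|_]; last exact: leNye.
  by rewrite lee_fin le_max /= lexx orbT.
have K0 : 0 <= K by rewrite /K le_max lexx.
have moment j : (\int[P]_w (sup_norm (cball d a)
    (dirderiv (cball d a) k (unit_vec j) (fun t => X t w)) ^+ m) <= K%:E)%E.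
  apply: le_trans SK; apply: ereal_sup_ubound.
  by exists (unit_vec j) => //; exact: usphere_unit_vec.
exact: (level_moment_finite d0 ha hk mN0 PN0 smooth (ltW C0) K0 small moment hp hpk k2).
Qed.
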